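(* For each of the following four choices of coefficients $(a,b)$: (1) Pascal: $a(n,k)=1$, $b(n,k)=1$; (2) Stirling numbers of the second kind: $a(n,k)=1$, $b(n,k)=k$; (3) (unsigned) Stirling numbers of the first kind: $a(n,k)=1$, $b(n,k)=n-1$; (4) Euler: $a(n,k)=n-k$, $b(n,k)=k+1$; let $(T(n,k))_{0\le k\le n}$ be the corresponding combinatorial triangle and let $p_1(n,k)=\dfrac{a(n,k)\,T(n-1,k-1)}{T(n,k)}$. Then, in each of the four cases, there exists a function $\varphi:(0,+\infty)\to[0,1]$ such that, for any real number $\lambda_\infty>0$, when $m$ and $\ell$ tend to $+\infty$ with $\lim m/\ell=1+\lambda_\infty$, $$\lim p_1(m,\ell)=\varphi(\lambda_\infty).$$
   Context: The triangle $(T(n,k))_{0\le k\le n}$ of nonnegative integers associated with $(a,b)$ is determined by $T(0,0)=1$, the convention $T(n,k)=0$ unless $0\le k\le n$, and the recursion $$T(n,k)=a(n,k)T(n-1,k-1)+b(n,k)T(n-1,k),\qquad 0\le k\le n,\ (n,k)\neq(0,0).$$ In the four cases $T(n,k)$ is, respectively, the binomial coefficient $\binom nk$, the number of partitions of an $n$-set into $k$ nonempty blocks, the number of permutations of $n$ elements with $k$ cycles, and the Eulerian number counting permutations of $n$ elements with $k$ descents. The ratio $p_1(n,k)$ is considered where $T(n,k)\neq 0$; in particular it is defined whenever $0<k<n$. The limit is taken along pairs of integers $(m,\ell)$ with both $m\to+\infty$ and $\ell\to+\infty$ (so that, eventually, $0<\ell<m$). *)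

(* Defs.v *)
From Stdlib Require Import Reals Arith Lia.
From Coquelicot Require Import Coquelicot.

Local Open Scope nat_scope.

(* T(n,k).  Entries outside 0 <= k <= n are 0: for k > n this follows from the
   recursion (lemma triangle_gt), and T(n-1,-1) is the explicit 0 branch. *)
Fixpoint triangle (a b : nat -> nat -> nat) (n k : nat) {struct n} : nat :=
  match n with
  | O => match k with O => 1 | S _ => 0 end
  | S n' =>
      a n k * match k with O => 0 | S k' => triangle a b n' k' end
      + b n k * triangle a b n' k
  end.

Lemma triangle_gt (a b : nat -> nat -> nat) (n k : nat) :
  n < k -> triangle a b n k = 0.
Proof.
revert k; induction n as [|n IH]; intros [|k] H; try lia; cbn [triangle].
- reflexivity.
- rewrite !IH by lia; lia.
Qed.

Lemma triangle_rec (a b : nat -> nat -> nat) (n k : nat) :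
  0 < n -> 0 < k ->
  triangle a b n k =
  a n k * triangle a b (n - 1) (k - 1) + b n k * triangle a b (n - 1) k.
Proof.
destruct n as [|n], k as [|k]; try lia; intros _ _.
rewrite !Nat.sub_succ, !Nat.sub_0_r; reflexivity.
Qed.

Lemma triangle_rec0 (a b : nat -> nat -> nat) (n : nat) :
  0 < n -> triangle a b n 0 = b n 0 * triangle a b (n - 1) 0.
Proof.
destruct n as [|n]; try lia; intros _.
rewrite Nat.sub_succ, Nat.sub_0_r; cbn [triangle]; lia.
Qed.

(* The last branch is the convention T(n-1,k-1) = 0 for n = 0 or k = 0.  The
   value is meaningful only where T(n,k) <> 0, in particular for 0 < k < n in
   the four cases below. *)
Definition p1 (a b : nat -> nat -> nat) (n k : nat) : R :=
  match n, k with
  | S n', S k' =>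
      (INR (a n k) * INR (triangle a b n' k') / INR (triangle a b n k))%R
  | _, _ => 0%R
  end.

Inductive triangle_case : Set := Pascal | Stirling2 | Stirling1 | Euler.

(* The subtractions are truncated, but are exact wherever the recursion is used
   in the range 0 <= k <= n, (n,k) <> (0,0). *)
Definition coef_a (c : triangle_case) (n k : nat) : nat :=
  match c with
  | Pascal | Stirling2 | Stirling1 => 1
  | Euler => n - k
  end.

Definition coef_b (c : triangle_case) (n k : nat) : nat :=
  match c with
  | Pascal => 1
  | Stirling2 => k
  | Stirling1 => n - 1
  | Euler => k + 1
  end.

(* Main.v *)
Require Import Defs.
From Stdlib Require Import Reals Ranalysis5 Arith Lia Lra IndefiniteDescription.
From Coquelicot Require Import Coquelicot.
Local Open Scope R_scope.

(* [p1] is an explicit function of the ratio of two consecutive entries of a row (Stirling1, Euler)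
   or of a column (Stirling2) of the triangle, and these rows and columns are log-concave.  Let
   [a_N] be such a log-concave sequence whose generating function [G_N x] grows like
   [exp (N (Lambda x + s_N))].  If the ratio [a_N J / a_N (J + 1)] were larger than some
   [x' > x > x0], log-concavity would make the weights [a_N k * x ^ k] decay geometrically from
   [k = J] on, hence [G_N x <= C * (x / x0) ^ J * G_N x0]; when [J / N] tends to [kappa] this
   contradicts [Lambda x - Lambda x0 > kappa * ln (x / x0)], which holds if [x0] is the strict
   minimum of [Lambda x - kappa * ln x].  Ratios that are too small are excluded in the same way
   with [x < x0].  So the ratio tends to [x0].  The growth rates come from
   [sum_k c(n,k) x^k = x (x + 1) ... (x + n - 1)], from
   [sum_r S(r+k,k) z^r = 1 / ((1 - z) (1 - 2 z) ... (1 - k z))], and from Worpitzky's identity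
   [sum_k A(n,k) C(j+n-k,n) = (j+1)^n] for the Eulerian numbers.  The latter is used for [x < 1]
   only, i.e. for [kappa < 1/2]; the remaining [kappa] follow from [A(n,k) = A(n,n-1-k)]. *)

(** * Ratios of consecutive terms of log-concave sequences *)

(** Division-free form of: the ratios [a k / a (S k)] are nondecreasing. For nonnegative sequences,
    ranging over all [p <= q] and not only neighbours also excludes zeros between positive
    entries. *)
Definition log_concave (a : nat -> R) : Prop :=
  forall p q : nat, (p <= q)%nat -> a p * a (S q) <= a (S p) * a q.

(** With truncated subtraction, [k - K + (K - k)] is the distance of [k] and [K]; two geometric
    series meet at [K]. *)
Lemma sum_pow_dist_le (q : R) (K M : nat) :
  0 < q < 1 ->
  sum_f_R0 (fun k => q ^ (k - K + (K - k))) M <= 2 / (1 - q).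
Proof.
intros Hq.
assert (Hgeom : forall M, sum_f_R0 (fun k => q ^ k) M <= 1 / (1 - q)).
{ intros n. rewrite tech3 by lra.
  apply Rmult_le_compat_r; [apply Rlt_le, Rinv_0_lt_compat; lra|].
  assert (0 < q ^ S n) by (apply pow_lt; lra). lra. }
(* The sharper bound is the value of the whole series over [k]; unlike the rounded one, it passes
   through the induction on [K]. *)
enough (H : sum_f_R0 (fun k => q ^ (k - K + (K - k))) M
            <= (1 + q - q ^ S K) / (1 - q)).
{ eapply Rle_trans; [exact H|].
  apply Rmult_le_compat_r; [apply Rlt_le, Rinv_0_lt_compat; lra|].
  assert (0 < q ^ S K) by (apply pow_lt; lra). lra. }
revert M; induction K as [|K IH]; intros M.
- replace (1 + q - q ^ 1) with 1 by ring.
  rewrite (sum_eq _ (fun k => q ^ k)); [apply Hgeom|].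
  intros i _; f_equal; lia.
- assert (HS : (1 + q - q ^ S (S K)) / (1 - q)
               = q ^ S K + (1 + q - q ^ S K) / (1 - q)).
  { simpl; field; lra. }
  rewrite HS. destruct M as [|M].
  + assert (q ^ S K <= 1).
    { rewrite <- (pow1 (S K)); apply pow_incr; lra. }
    assert (0 < (1 + q - q ^ S K) / (1 - q)); [|simpl in *; lra].
    apply Rdiv_lt_0_compat; lra.
  + rewrite decomp_sum by lia. apply Rplus_le_compat; [simpl; lra|].
    apply IH.
Qed.

Lemma sum_f_R0_le_of_pow_dist (f : nat -> R) (q B : R) (K M : nat) :
  0 < q < 1 -> (forall k, f k <= B * q ^ (k - K + (K - k))) -> 0 <= B ->
  sum_f_R0 f M <= 2 / (1 - q) * B.
Proof.
intros Hq Hf HB.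
eapply Rle_trans; [apply sum_Rle; intros; apply Hf|].
rewrite (sum_eq _ (fun k => q ^ (k - K + (K - k)) * B)) by (intros; ring).
rewrite <- scal_sum, (Rmult_comm (2 / (1 - q))).
apply Rmult_le_compat_l; [exact HB|apply sum_pow_dist_le, Hq].
Qed.

Lemma is_lim_seq_eventually_lt (u : nat -> R) (l c : R) :
  is_lim_seq u l -> l < c -> eventually (fun i => u i < c).
Proof.
intros Hu Hc.
apply is_lim_seq_spec in Hu.
assert (He : 0 < c - l) by lra.
destruct (Hu (mkposreal _ He)) as [i0 Hi0]; exists i0; intros i Hi.
specialize (Hi0 i Hi); simpl in Hi0. apply Rabs_lt_between in Hi0; lra.
Qed.

Lemma is_lim_seq_eventually_gt (u : nat -> R) (l c : R) :
  is_lim_seq u l -> c < l -> eventually (fun i => c < u i).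
Proof.
intros Hu Hc.
apply is_lim_seq_spec in Hu.
assert (He : 0 < l - c) by lra.
destruct (Hu (mkposreal _ He)) as [i0 Hi0]; exists i0; intros i Hi.
specialize (Hi0 i Hi); simpl in Hi0. apply Rabs_lt_between in Hi0; lra.
Qed.

Lemma is_lim_seq_p_infty_gt (u : nat -> R) (c : R) :
  is_lim_seq u p_infty -> eventually (fun i => c < u i).
Proof. intros Hu; apply is_lim_seq_spec in Hu; exact (Hu c). Qed.

(** After taking logarithms and dividing by [N i], the left side tends to [kappa * ln y], as
    [ln C / N i] vanishes. *)
Lemma pow_lt_exp_eventually (N : nat -> R) (K : nat -> nat) (kappa C y d : R) :
  0 < C -> 0 < y -> kappa * ln y < d ->
  is_lim_seq N p_infty ->
  is_lim_seq (fun i => INR (K i) / N i) kappa ->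
  eventually (fun i => C * y ^ K i < exp (d * N i)).
Proof.
intros HC Hy Hd HN HK.
assert (Hlim : is_lim_seq (fun i => ln C * / N i + INR (K i) / N i * ln y)
                 (kappa * ln y)).
{ replace (kappa * ln y) with (ln C * 0 + kappa * ln y) by ring.
  apply is_lim_seq_plus'.
  - apply (is_lim_seq_scal_l _ (ln C) 0).
    apply (is_lim_seq_inv _ p_infty); [exact HN|discriminate].
  - apply (is_lim_seq_scal_r _ (ln y) kappa), HK. }
generalize (filter_and _ _ (is_lim_seq_eventually_lt _ _ _ Hlim Hd)
                           (is_lim_seq_p_infty_gt _ 0 HN)).
apply filter_imp; intros i [H1 H2].
rewrite <- (exp_ln C) by lra.
rewrite <- Rpower_pow by lra. unfold Rpower.
rewrite <- exp_plus. apply exp_increasing.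
apply (Rmult_lt_compat_r (N i)) in H1; [|lra].
replace ((ln C * / N i + INR (K i) / N i * ln y) * N i)
  with (ln C + INR (K i) * ln y) in H1 by (field; lra).
lra.
Qed.

(** The ratios are nondecreasing, so a ratio of at least [x] at [J] persists to the right of [J]. *)
Lemma log_concave_decay (a : nat -> R) (x : R) (J r : nat) :
  log_concave a -> 0 < x -> 0 < a J -> x * a (S J) <= a J ->
  (forall k, 0 <= a k) ->
  a (J + r)%nat * x ^ r <= a J.
Proof.
intros Ha Hx HJ Hr Hpos.
induction r as [|r IH].
- rewrite Nat.add_0_r; simpl; lra.
- rewrite Nat.add_succ_r.
  assert (H : x * a (S (J + r)) <= a (J + r)%nat).
  { specialize (Ha J (J + r)%nat ltac:(lia)).
    apply Rmult_le_reg_l with (a J); [exact HJ|].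
    generalize (Rmult_le_compat_r (a (J + r)%nat) _ _ (Hpos _) Hr).
    generalize (Rmult_le_compat_l x _ _ (Rlt_le _ _ Hx) Ha). lra. }
  assert (Hp : 0 < x ^ r) by (apply pow_lt; lra).
  simpl. generalize (Rmult_le_compat_r (x ^ r) _ _ (Rlt_le _ _ Hp) H). lra.
Qed.

(** Mirror image: a ratio of at most [x] at [J] persists to the left of [J]. *)
Lemma log_concave_growth (a : nat -> R) (x : R) (J r : nat) :
  log_concave a -> 0 < x -> 0 < a (S J) -> a J <= x * a (S J) ->
  (forall k, 0 <= a k) -> (r <= S J)%nat ->
  a (S J - r)%nat <= a (S J) * x ^ r.
Proof.
intros Ha Hx HJ Hr Hpos.
induction r as [|r IH]; intros HrJ.
- rewrite Nat.sub_0_r; simpl; lra.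
- specialize (IH ltac:(lia)).
  replace (S J - r)%nat with (S (S J - S r)) in IH by lia.
  set (p := (S J - S r)%nat) in *.
  assert (H : a p <= x * a (S p)).
  { specialize (Ha p J ltac:(unfold p; lia)).
    apply Rmult_le_reg_r with (a (S J)); [exact HJ|].
    generalize (Rmult_le_compat_l (a (S p)) _ _ (Hpos _) Hr). lra. }
  simpl. generalize (Rmult_le_compat_l x _ _ (Rlt_le _ _ Hx) IH). lra.
Qed.

(* Compares the weights [a i k x ^ k] of the tilted row at [x] with those at [x0]: the total at
   [x] exceeds every single weight at [x0] by an exponential factor beating [(x / x0) ^ (kappa N)]. *)
Definition outgrows (a : nat -> nat -> R) (N : nat -> R) (kappa x0 x : R) : Prop :=
  exists d : R, kappa * ln (x / x0) < d /\
    eventually (fun i => exists (U : R) (M : nat),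
      (forall k, a i k * x0 ^ k <= U) /\
      exp (d * N i) * U <= sum_f_R0 (fun k => a i k * x ^ k) M).

(** [P] will be the desired bound on the ratio. Where it fails, the weights at [x] decay
    geometrically away from [K i], so their sum is at most a constant times [(x / x0) ^ K i * U].
    This contradicts the growth factor [exp (d * N i)], since [kappa * ln (x / x0) < d]. *)
Lemma outgrows_not_concentrated (a : nat -> nat -> R) (N : nat -> R) (kappa x0 x q : R)
    (K : nat -> nat) (P : nat -> Prop) :
  0 < x0 -> 0 < x -> 0 < q < 1 ->
  is_lim_seq N p_infty -> is_lim_seq (fun i => INR (K i) / N i) kappa ->
  outgrows a N kappa x0 x ->
  eventually (fun i => 0 < a i (K i)) ->
  eventually (fun i => P i \/ forall U, (forall k, a i k * x0 ^ k <= U) ->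
     forall k, a i k * x ^ k <= (x / x0) ^ K i * U * q ^ (k - K i + (K i - k))) ->
  eventually P.
Proof.
intros Hx0 Hx Hq HN HK [d [Hd Hg]] HaK HP.
assert (Hy : 0 < x / x0) by (apply Rdiv_lt_0_compat; lra).
assert (HC : 0 < 2 / (1 - q)) by (apply Rdiv_lt_0_compat; lra).
generalize (filter_and _ _ (filter_and _ _ Hg HaK) (filter_and _ _ HP
  (pow_lt_exp_eventually N K kappa _ _ d HC Hy Hd HN HK))).
apply filter_imp; intros i [[[U [M [HU HM]]] Ha] [[H|H] Hlt]]; [exact H|exfalso].
assert (HU0 : 0 < U).
{ eapply Rlt_le_trans; [|apply (HU (K i))].
  apply Rmult_lt_0_compat; [exact Ha|apply pow_lt, Hx0]. }
assert (Hp : 0 < (x / x0) ^ K i) by (apply pow_lt, Hy).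
assert (HS := sum_f_R0_le_of_pow_dist _ q _ (K i) M Hq (H U HU)
   ltac:(apply Rmult_le_pos; lra)).
generalize (Rmult_lt_compat_r U _ _ HU0 Hlt). lra.
Qed.

Lemma pow_div_split (x y : R) (j k : nat) :
  y <> 0 -> x <> 0 -> (j <= k)%nat ->
  (x / y) ^ j = (x / y) ^ k * (y / x) ^ (k - j).
Proof.
intros Hy Hx Hjk.
replace k with (j + (k - j))%nat at 1 by lia.
rewrite pow_add, Rmult_assoc, <- Rpow_mult_distr.
replace (x / y * (y / x)) with 1 by (field; lra).
rewrite pow1; ring.
Qed.

Section Ratio.
Variables (a : nat -> nat -> R) (N : nat -> R) (J : nat -> nat) (kappa x0 : R).
Hypothesis Hlc : forall i, log_concave (a i).
Hypothesis Hpos : forall i k, 0 <= a i k.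
Hypothesis HaJ : eventually (fun i => 0 < a i (J i) /\ 0 < a i (S (J i))).
Hypothesis HN : is_lim_seq N p_infty.
Hypothesis HJ : is_lim_seq (fun i => INR (J i) / N i) kappa.
Hypothesis Hx0 : 0 < x0.

(** Suppose the ratio at [J] exceeds [x']. Right of [J], log-concavity makes the weights at [x]
    decay like powers of [x / x']. Left of [J], the bound [U] at [x0] alone gives decay by [x0 / x].
    The slower of the two rates is [q]. *)
Lemma ratio_eventually_le (x x' : R) :
  x0 < x < x' -> outgrows a N kappa x0 x ->
  eventually (fun i => a i (J i) <= x' * a i (S (J i))).
Proof.
intros Hx Hg.
set (q := Rmax (x0 / x) (x / x')).
assert (Hq1 : x0 / x < 1) by (apply (Rdiv_lt_1 x0 x); lra).
assert (Hq2 : x / x' < 1) by (apply (Rdiv_lt_1 x x'); lra).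
assert (Hq3 : 0 < x0 / x) by (apply Rdiv_lt_0_compat; lra).
assert (Hq4 : 0 < x / x') by (apply Rdiv_lt_0_compat; lra).
assert (Hq : 0 < q < 1).
{ split; [eapply Rlt_le_trans; [|apply Rmax_l]; lra|].
  apply Rmax_lub_lt; lra. }
apply (outgrows_not_concentrated a N kappa x0 x q J); try assumption; try lra.
{ revert HaJ; apply filter_imp; tauto. }
revert HaJ; apply filter_imp; intros i [HJ0 HJ1].
destruct (Rle_dec (a i (J i)) (x' * a i (S (J i)))) as [H|H]; [now left|right].
intros U HU k.
assert (Hp : forall n, 0 < (x / x0) ^ n)
  by (intros n; apply pow_lt, Rdiv_lt_0_compat; lra).
assert (HUk : forall j, a i j * x ^ j <= (x / x0) ^ j * U).
{ intros j. replace (x ^ j) with ((x / x0) ^ j * x0 ^ j).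
  - generalize (Rmult_le_compat_l _ _ _ (Rlt_le _ _ (Hp j)) (HU j)); lra.
  - rewrite <- Rpow_mult_distr; f_equal; field; lra. }
assert (HU0 : 0 <= U).
{ eapply Rle_trans; [|apply (HU O)]. apply Rmult_le_pos; [apply Hpos|simpl; lra]. }
destruct (Nat.le_gt_cases k (J i)) as [Hk|Hk].
- eapply Rle_trans; [apply HUk|].
  rewrite (pow_div_split x x0 k (J i)) by (lra || lia).
  replace (k - J i + (J i - k))%nat with (J i - k)%nat by lia.
  assert ((x0 / x) ^ (J i - k) <= q ^ (J i - k)).
  { apply pow_incr; split; [lra|apply Rmax_l]. }
  generalize (Rmult_le_compat_l ((x / x0) ^ J i * U) _ _
    (Rmult_le_pos _ _ (Rlt_le _ _ (Hp _)) HU0) H0). lra.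
- assert (Hd := log_concave_decay (a i) x' (J i) (k - J i) (Hlc i) ltac:(lra) HJ0
    ltac:(lra) (Hpos i)).
  replace (J i + (k - J i))%nat with k in Hd by lia.
  replace (k - J i + (J i - k))%nat with (k - J i)%nat by lia.
  set (r := (k - J i)%nat) in *.
  assert (Hr : (x / x') ^ r <= q ^ r).
  { apply pow_incr; split; [lra|apply Rmax_r]. }
  assert (Hr0 : 0 < (x / x') ^ r) by (apply pow_lt; lra).
  assert (HxJ : 0 < x ^ J i) by (apply pow_lt; lra).
  apply Rle_trans with (a i (J i) * x ^ J i * (x / x') ^ r).
  + replace (x ^ k) with (x ^ J i * (x' ^ r * (x / x') ^ r)).
    * generalize (Rmult_le_compat_r (x ^ J i * (x / x') ^ r) _ _
        (Rlt_le _ _ (Rmult_lt_0_compat _ _ HxJ Hr0)) Hd). lra.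
    * rewrite <- Rpow_mult_distr. replace (x' * (x / x')) with x by (field; lra).
      rewrite <- pow_add; f_equal; unfold r; lia.
  + apply Rmult_le_compat; try lra; [|apply HUk].
    apply Rmult_le_pos; [apply Hpos|lra].
Qed.

(** As before with the sides exchanged: the weights are centred at [S (J i)], log-concavity acts on
    the left and the bound at [x0] on the right. *)
Lemma ratio_eventually_ge (x x' : R) :
  0 < x' < x -> x < x0 -> outgrows a N kappa x0 x ->
  eventually (fun i => x' * a i (S (J i)) <= a i (J i)).
Proof.
intros Hx Hxx Hg.
set (q := Rmax (x / x0) (x' / x)).
assert (Hq1 : x / x0 < 1) by (apply (Rdiv_lt_1 x x0); lra).
assert (Hq2 : x' / x < 1) by (apply (Rdiv_lt_1 x' x); lra).
assert (Hq3 : 0 < x / x0) by (apply Rdiv_lt_0_compat; lra).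
assert (Hq4 : 0 < x' / x) by (apply Rdiv_lt_0_compat; lra).
assert (Hq : 0 < q < 1).
{ split; [eapply Rlt_le_trans; [|apply Rmax_l]; lra|].
  apply Rmax_lub_lt; lra. }
apply (outgrows_not_concentrated a N kappa x0 x q (fun i => S (J i))); try assumption; try lra.
{ apply is_lim_seq_ext with (fun i => INR (J i) / N i + / N i).
  { intros i; rewrite S_INR; unfold Rdiv; ring. }
  replace kappa with (kappa + 0) by ring.
  apply is_lim_seq_plus'; [exact HJ|].
  apply (is_lim_seq_inv _ p_infty); [exact HN|discriminate]. }
{ revert HaJ; apply filter_imp; tauto. }
revert HaJ; apply filter_imp; intros i [HJ0 HJ1].
destruct (Rle_dec (x' * a i (S (J i))) (a i (J i))) as [H|H]; [now left|right].
intros U HU k. set (K := S (J i)) in *.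
assert (Hp : forall n, 0 < (x / x0) ^ n)
  by (intros n; apply pow_lt, Rdiv_lt_0_compat; lra).
assert (HUk : forall j, a i j * x ^ j <= (x / x0) ^ j * U).
{ intros j. replace (x ^ j) with ((x / x0) ^ j * x0 ^ j).
  - generalize (Rmult_le_compat_l _ _ _ (Rlt_le _ _ (Hp j)) (HU j)); lra.
  - rewrite <- Rpow_mult_distr; f_equal; field; lra. }
assert (HU0 : 0 <= U).
{ eapply Rle_trans; [|apply (HU O)]. apply Rmult_le_pos; [apply Hpos|simpl; lra]. }
destruct (Nat.le_gt_cases k K) as [Hk|Hk].
- assert (Hd := log_concave_growth (a i) x' (J i) (K - k) (Hlc i) ltac:(lra) HJ1
    ltac:(fold K; lra) (Hpos i) ltac:(unfold K; lia)).
  fold K in Hd.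
  replace (K - (K - k))%nat with k in Hd by lia.
  replace (k - K + (K - k))%nat with (K - k)%nat by lia.
  set (r := (K - k)%nat) in *.
  assert (Hr : (x' / x) ^ r <= q ^ r).
  { apply pow_incr; split; [lra|apply Rmax_r]. }
  assert (Hr0 : 0 < (x' / x) ^ r) by (apply pow_lt; lra).
  assert (Hxk : 0 < x ^ k) by (apply pow_lt; lra).
  apply Rle_trans with (a i K * x ^ K * (x' / x) ^ r).
  + replace (x ^ K) with (x ^ k * x ^ r)
      by (rewrite <- pow_add; f_equal; unfold r; lia).
    replace (a i K * (x ^ k * x ^ r) * (x' / x) ^ r)
      with (a i K * x' ^ r * x ^ k).
    * apply Rmult_le_compat_r; lra.
    * replace x' with (x * (x' / x)) at 1 by (field; lra).
      rewrite Rpow_mult_distr; ring.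
  + apply Rmult_le_compat; try lra; [|apply HUk].
    apply Rmult_le_pos; [lra|apply pow_le; lra].
- eapply Rle_trans; [apply HUk|].
  replace k with (K + (k - K))%nat at 1 by lia.
  replace (k - K + (K - k))%nat with (k - K)%nat by lia.
  rewrite pow_add.
  assert ((x / x0) ^ (k - K) <= q ^ (k - K)).
  { apply pow_incr; split; [lra|apply Rmax_l]. }
  generalize (Rmult_le_compat_l ((x / x0) ^ K * U) _ _
    (Rmult_le_pos _ _ (Rlt_le _ _ (Hp _)) HU0) H0). lra.
Qed.

(** Only [x] near [x0] are required, because some of the generating functions are controlled on
    [x < 1] only. *)
Lemma ratio_is_lim (e : R) :
  0 < e ->
  (forall x, Rabs (x - x0) < e -> 0 < x -> x <> x0 -> outgrows a N kappa x0 x) ->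
  is_lim_seq (fun i => a i (J i) / a i (S (J i))) x0.
Proof.
intros He Hg.
apply is_lim_seq_spec; intros [eps Heps]; simpl.
(* [h < e] keeps the test points where [outgrows] is known, [h < eps] gives the accuracy, and
   [h < x0] keeps [x0 - h] positive. *)
set (h := Rmin (Rmin e eps) x0 / 2).
assert (Hh : 0 < h /\ h < e /\ h < eps /\ h < x0).
{ assert (0 < Rmin (Rmin e eps) x0) by (repeat apply Rmin_glb_lt; assumption).
  assert (Rmin (Rmin e eps) x0 <= Rmin e eps) by apply Rmin_l.
  assert (Rmin (Rmin e eps) x0 <= x0) by apply Rmin_r.
  assert (Rmin e eps <= e) by apply Rmin_l.
  assert (Rmin e eps <= eps) by apply Rmin_r.
  unfold h; lra. }
assert (Hle := ratio_eventually_le (x0 + h / 2) (x0 + h) ltac:(lra)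
  ltac:(apply Hg; [rewrite Rabs_pos_eq; lra|lra|lra])).
assert (Hge := ratio_eventually_ge (x0 - h / 2) (x0 - h) ltac:(lra) ltac:(lra)
  ltac:(apply Hg; [rewrite Rabs_left; lra|lra|lra])).
generalize (filter_and _ _ HaJ (filter_and _ _ Hle Hge)).
apply filter_imp; intros i [[H1 H2] [H3 H4]].
apply Rabs_lt_between. split.
- apply Rlt_le_trans with (x0 - h - x0); [lra|].
  apply Rplus_le_compat_r. apply Rle_div_r; assumption.
- apply Rle_lt_trans with (x0 + h - x0); [|lra].
  apply Rplus_le_compat_r. apply Rle_div_l; assumption.
Qed.

End Ratio.

(** * Exponential growth rates *)

Definition convex_dom (D : R -> Prop) : Prop :=
  forall x y z, D x -> D z -> x <= y <= z -> D y.

Lemma is_derive_pos_increasing (D : R -> Prop) (f f' : R -> R) :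
  convex_dom D -> (forall x, D x -> is_derive f x (f' x)) ->
  (forall x, D x -> 0 < f' x) ->
  forall x y, D x -> D y -> x < y -> f x < f y.
Proof.
intros HD Hf Hpos x y Hx Hy Hxy.
destruct (MVT_cor2 f f' x y Hxy) as [c [Hc1 Hc2]].
{ intros c Hc; apply is_derive_Reals, Hf, (HD x c y); assumption. }
assert (0 < f' c) by (apply Hpos, (HD x c y); assumption || lra).
generalize (Rmult_lt_0_compat (f' c) (y - x)). lra.
Qed.

(** Meant for [H x = Lambda x - kappa * ln x] with [w x = / x] and [g x = x * Lambda' x]: the
    derivative of [H] has the sign of [x - x0]. *)
Lemma sign_change_strict_min (D : R -> Prop) (H w g : R -> R) (x0 : R) :
  convex_dom D ->
  (forall x, D x -> is_derive H x (w x * (g x - g x0))) ->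
  (forall x, D x -> 0 < w x) ->
  (forall x y, D x -> D y -> x < y -> g x < g y) ->
  D x0 -> forall x, D x -> x <> x0 -> H x0 < H x.
Proof.
intros HD HH Hw Hg Hx0 x Hx Hne.
destruct (Rlt_dec x x0) as [Hlt|Hge].
- destruct (MVT_cor2 H (fun y => w y * (g y - g x0)) x x0 Hlt) as [c [Hc1 Hc2]].
  { intros c Hc; apply is_derive_Reals, HH, (HD x c x0); assumption. }
  assert (Dc : D c) by (apply (HD x c x0); assumption || lra).
  generalize (Rmult_lt_0_compat (w c * (g x0 - g c)) (x0 - x)
    (Rmult_lt_0_compat _ _ (Hw c Dc) (proj2 (Rlt_0_minus _ _) (Hg c x0 Dc Hx0 (proj2 Hc2))))
    ltac:(lra)). lra.
- assert (Hlt : x0 < x) by lra.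
  destruct (MVT_cor2 H (fun y => w y * (g y - g x0)) x0 x Hlt) as [c [Hc1 Hc2]].
  { intros c Hc; apply is_derive_Reals, HH, (HD x0 c x); assumption. }
  assert (Dc : D c) by (apply (HD x0 c x); assumption || lra).
  generalize (Rmult_lt_0_compat (w c * (g c - g x0)) (x - x0)
    (Rmult_lt_0_compat _ _ (Hw c Dc) (proj2 (Rlt_0_minus _ _) (Hg x0 c Hx0 Dc (proj1 Hc2))))
    ltac:(lra)). lra.
Qed.

Lemma increasing_ivt (D : R -> Prop) (g g' : R -> R) (a b y : R) :
  convex_dom D -> (forall x, D x -> is_derive g x (g' x)) ->
  (forall x, D x -> 0 < g' x) ->
  D a -> D b -> g a < y < g b -> exists x, D x /\ g x = y.
Proof.
intros HD Hg Hg' Ha Hb Hy.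
assert (Hab : a < b).
{ destruct (Rtotal_order a b) as [H|[H|H]]; [exact H|subst; lra|].
  generalize (is_derive_pos_increasing D g g' HD Hg Hg' b a Hb Ha H); lra. }
destruct (Ranalysis5.IVT_interv (fun x => g x - y) a b) as [x [Hx1 Hx2]]; try lra.
{ intros c Hc. apply continuity_pt_minus; [|apply continuity_pt_const; intros ? ?; reflexivity].
  apply derivable_continuous_pt. exists (g' c). apply is_derive_Reals, Hg.
  apply (HD a c b); assumption. }
exists x; split; [apply (HD a x b); assumption|lra].
Qed.

(** * Elementary inequalities for [exp] and [ln] *)

Lemma exp_le_exp (x y : R) : x <= y -> exp x <= exp y.
Proof.
intros [H|H]; [apply Rlt_le, exp_increasing, H|rewrite H; apply Rle_refl].
Qed.

Lemma ln_lt_sub_1 (x : R) : 0 < x -> x <> 1 -> ln x < x - 1.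
Proof.
intros Hx Hne.
assert (Hl : ln x <> 0).
{ intros H; apply Hne. rewrite <- (exp_ln x Hx), H; apply exp_0. }
generalize (exp_ineq1 (ln x) Hl). rewrite (exp_ln x Hx); lra.
Qed.

Lemma ln_le_sub_1 (x : R) : 0 < x -> ln x <= x - 1.
Proof.
intros Hx; destruct (Req_dec x 1) as [->|Hne]; [rewrite ln_1; lra|].
apply Rlt_le, ln_lt_sub_1; assumption.
Qed.

(** An antiderivative of [ln]. Sums of logarithms in the products below are compared with its
    differences. *)
Definition xlnx (y : R) : R := y * ln y - y.

(** Convexity: the graph lies above its tangent at [y], whose slope is [ln y]. It is
    [ln (y / z) <= y / z - 1] multiplied by [z]. *)
Lemma xlnx_tangent (y z : R) :
  0 < y -> 0 < z -> xlnx y + (z - y) * ln y <= xlnx z.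
Proof.
intros Hy Hz. unfold xlnx.
assert (H := ln_le_sub_1 (y / z) (Rdiv_lt_0_compat _ _ Hy Hz)).
rewrite ln_div in H by assumption.
apply (Rmult_le_compat_l z) in H; [|lra].
replace (z * (y / z - 1)) with (y - z) in H by (field; lra). lra.
Qed.

(** Division by [exp (t / 2)] turns this into [t < 2 * sinh (t / 2)], and the derivative
    [cosh (t / 2)] of the right side exceeds 1. *)
Lemma exp_sinh_lt (t : R) : 0 < t -> t * exp (t / 2) < exp t - 1.
Proof.
intros Ht.
assert (H : 0 < exp (t / 2) - exp (- t / 2) - t).
{ set (f := fun t => exp (t / 2) - exp (- t / 2) - t).
  destruct (MVT_cor2 f (fun t => exp (t / 2) / 2 + exp (- t / 2) / 2 - 1) 0 t Ht)
    as [c [Hc1 Hc2]].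
  { intros c _. apply is_derive_Reals. unfold f.
    auto_derive; [trivial|unfold Rdiv; rewrite ?Ropp_mult_distr_l; lra]. }
  assert (Hf0 : f 0 = 0).
  { unfold f. replace (- 0 / 2) with 0 by field. replace (0 / 2) with 0 by field. ring. }
  (* The expression is half the square of [exp (c / 4) - exp (- c / 4)]. *)
  assert (Hc : 0 < exp (c / 2) / 2 + exp (- c / 2) / 2 - 1).
  { assert (H1 : exp (c / 4) > exp (- c / 4)) by (apply exp_increasing; lra).
    assert (H2 : exp (c / 4) * exp (- c / 4) = 1).
    { rewrite <- exp_plus, <- exp_0; f_equal; field. }
    replace (c / 2) with (c / 4 + c / 4) by field.
    replace (- c / 2) with (- c / 4 + - c / 4) by field.
    rewrite !exp_plus. nra. }
  fold (f t). generalize (Rmult_lt_0_compat _ _ Hc Ht). lra. }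
assert (He := exp_pos (t / 2)).
apply (Rmult_lt_compat_r _ _ _ He) in H.
rewrite !Rmult_minus_distr_r, Rmult_0_l, <- !exp_plus in H.
replace (t / 2 + t / 2) with t in H by field.
replace (- t / 2 + t / 2) with 0 in H by field.
rewrite exp_0 in H. lra.
Qed.

(* The rate is the function [Lambda] of the argument above, with [x] scaled to [n * t], [t / k] and
   [x] in the three cases; the mean is [t * Lambda' t]. *)
Definition stirling1_rate (t : R) : R := (t + 1) * ln (t + 1) - t * ln t.
Definition stirling1_mean (t : R) : R := t * (ln (t + 1) - ln t).

Lemma convex_dom_pos : convex_dom (fun x => 0 < x).
Proof. intros x y z; lra. Qed.

Lemma convex_dom_01 : convex_dom (fun x => 0 < x < 1).
Proof. intros x y z; lra. Qed.

Lemma stirling1_mean_derive (t : R) :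
  0 < t -> is_derive stirling1_mean t (ln (t + 1) - ln t - / (t + 1)).
Proof. intros Ht; unfold stirling1_mean; auto_derive; [lra|unfold Rminus; field; lra]. Qed.

Lemma ln_succ_gt (t : R) : 0 < t -> / (t + 1) < ln (t + 1) - ln t.
Proof.
intros Ht.
assert (H := ln_lt_sub_1 (t / (t + 1)) ltac:(apply Rdiv_lt_0_compat; lra)).
rewrite ln_div in H by lra.
assert (E : t / (t + 1) = 1 - / (t + 1)) by (field; lra).
assert (0 < / (t + 1)) by (apply Rinv_0_lt_compat; lra).
lra.
Qed.

Lemma stirling1_mean_surj (kappa : R) : 0 < kappa < 1 -> exists t, 0 < t /\ stirling1_mean t = kappa.
Proof.
intros Hk.
(* At [t = / (exp y - 1)] the quotient [(t + 1) / t] is [exp y], so the mean is [y / (exp y - 1)],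
   below [/ (1 + y / 2)]. The choice of [y] makes this less than [kappa]. *)
set (y := 4 / kappa).
assert (Hy : 0 < y) by (apply Rdiv_lt_0_compat; lra).
assert (Hey : y * (1 + y / 2) < exp y - 1).
{ eapply Rlt_trans; [|apply exp_sinh_lt, Hy].
  apply Rmult_lt_compat_l; [exact Hy|].
  apply exp_ineq1; lra. }
assert (He : 0 < exp y - 1) by nra.
assert (Ha : 0 < / (exp y - 1)) by (apply Rinv_0_lt_compat; exact He).
(* This point [b] satisfies [b / (b + 1) = kappa], so [ln_succ_gt] puts the mean at [b] above
   [kappa]. *)
assert (Hb : 0 < kappa / (1 - kappa)) by (apply Rdiv_lt_0_compat; lra).
apply (increasing_ivt _ stirling1_mean _ (/ (exp y - 1)) (kappa / (1 - kappa)) kappa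
         convex_dom_pos stirling1_mean_derive).
- intros x Hx; generalize (ln_succ_gt x Hx); lra.
- exact Ha.
- exact Hb.
- unfold stirling1_mean; split.
  + rewrite <- ln_div by lra.
    replace ((/ (exp y - 1) + 1) / / (exp y - 1)) with (exp y) by (field; lra).
    rewrite ln_exp.
    apply Rmult_lt_reg_l with (exp y - 1); [exact He|].
    replace ((exp y - 1) * (/ (exp y - 1) * y)) with y by (field; lra).
    eapply Rlt_trans; [|apply (Rmult_lt_compat_r kappa _ _ (proj1 Hk) Hey)].
    replace (y * (1 + y / 2) * kappa) with (y * kappa * (1 + y / 2)) by ring.
    replace (y * kappa) with 4 by (unfold y; field; lra). lra.
  + set (b := kappa / (1 - kappa)) in *.
    generalize (Rmult_lt_compat_l b _ _ Hb (ln_succ_gt b Hb)).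
    replace (b * / (b + 1)) with kappa by (unfold b; field; lra). lra.
Qed.

Lemma stirling1_rate_strict (kappa t0 t : R) :
  0 < t0 -> stirling1_mean t0 = kappa -> 0 < t -> t <> t0 ->
  kappa * ln (t / t0) < stirling1_rate t - stirling1_rate t0.
Proof.
intros H0 Hk Ht Hne.
enough (stirling1_rate t0 - kappa * ln t0 < stirling1_rate t - kappa * ln t)
  by (rewrite ln_div by assumption; lra).
apply (sign_change_strict_min _ (fun t => stirling1_rate t - kappa * ln t) (fun t => / t) stirling1_mean t0
   convex_dom_pos); try assumption.
- intros x Hx. unfold stirling1_rate; rewrite Hk; unfold stirling1_mean.
  auto_derive; [lra|unfold Rminus; field; lra].
- intros x Hx; apply Rinv_0_lt_compat, Hx.
- apply (is_derive_pos_increasing _ _ _ convex_dom_pos stirling1_mean_derive).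
  intros x Hx; generalize (ln_succ_gt x Hx); lra.
Qed.

(** The integral of [- ln (1 - t * s)] over [0 <= s <= 1]: the limiting average of the logarithms of
    the factors [/ (1 - j * z)], [j <= k], at [z = t / k]. *)
Definition stirling2_rate (t : R) : R := 1 + (1 - t) * ln (1 - t) / t.
Definition stirling2_mean (t : R) : R := - 1 - ln (1 - t) / t.

Lemma stirling2_mean_derive (t : R) :
  0 < t < 1 -> is_derive stirling2_mean t ((t / (1 - t) + ln (1 - t)) / t ^ 2).
Proof. intros Ht; unfold stirling2_mean; auto_derive; [lra|unfold Rminus; field; lra]. Qed.

Lemma stirling2_mean_derive_pos (t : R) :
  0 < t < 1 -> 0 < (t / (1 - t) + ln (1 - t)) / t ^ 2.
Proof.
intros Ht. apply Rdiv_lt_0_compat; [|apply pow_lt; lra].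
assert (H : / (1 - t) <> 1).
{ intros H. apply (f_equal Rinv) in H. rewrite Rinv_inv, Rinv_1 in H; lra. }
generalize (ln_lt_sub_1 (/ (1 - t)) ltac:(apply Rinv_0_lt_compat; lra) H).
rewrite ln_Rinv by lra.
replace (t / (1 - t)) with (/ (1 - t) - 1) by (field; lra). lra.
Qed.

Lemma stirling2_mean_surj (lambda : R) :
  0 < lambda -> exists t, (0 < t < 1) /\ stirling2_mean t = lambda.
Proof.
intros Hl.
(* At [t = 1 - exp (- y)] the mean is [y / (1 - exp (- y)) - 1]. It is below [lambda] for
   [y = lambda] and above it for [y = 1 + lambda]. *)
assert (Hexp : forall y, 0 < y -> 0 < 1 - exp (- y) < 1 /\ 1 - (1 - exp (- y)) = exp (- y)).
{ intros y Hy. assert (exp (- y) < exp 0) by (apply exp_increasing; lra).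
  rewrite exp_0 in H. generalize (exp_pos (- y)); lra. }
destruct (Hexp lambda Hl) as [Ha1 Ha2].
destruct (Hexp (1 + lambda) ltac:(lra)) as [Hb1 Hb2].
apply (increasing_ivt _ stirling2_mean _ _ _ lambda convex_dom_01
         stirling2_mean_derive stirling2_mean_derive_pos Ha1 Hb1).
unfold stirling2_mean; rewrite Ha2, Hb2, !ln_exp; split.
- assert (H : exp (- lambda) * (1 + lambda) < 1).
  { apply Rmult_lt_reg_l with (exp lambda); [apply exp_pos|].
    rewrite <- Rmult_assoc, <- exp_plus, Rplus_opp_r, exp_0.
    generalize (exp_ineq1 lambda ltac:(lra)); lra. }
  apply Rmult_lt_reg_l with (1 - exp (- lambda)); [lra|].
  replace ((1 - exp (- lambda)) * (-1 - - lambda / (1 - exp (- lambda))))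
    with (lambda - (1 - exp (- lambda))) by (field; lra). nra.
- apply Rmult_lt_reg_l with (1 - exp (- (1 + lambda))); [lra|].
  replace ((1 - exp (- (1 + lambda))) * (-1 - - (1 + lambda) / (1 - exp (- (1 + lambda)))))
    with (1 + lambda - (1 - exp (- (1 + lambda)))) by (field; lra). nra.
Qed.

Lemma stirling2_rate_strict (lambda t0 t : R) :
  0 < t0 < 1 -> stirling2_mean t0 = lambda -> 0 < t < 1 -> t <> t0 ->
  lambda * ln (t / t0) < stirling2_rate t - stirling2_rate t0.
Proof.
intros H0 Hk Ht Hne.
enough (stirling2_rate t0 - lambda * ln t0 < stirling2_rate t - lambda * ln t)
  by (rewrite ln_div by lra; lra).
apply (sign_change_strict_min _ (fun t => stirling2_rate t - lambda * ln t) (fun t => / t) stirling2_mean t0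
   convex_dom_01); try assumption.
- intros x Hx. unfold stirling2_rate; rewrite Hk; unfold stirling2_mean.
  auto_derive; [lra|unfold Rminus; field; lra].
- intros x Hx; apply Rinv_0_lt_compat; lra.
- apply (is_derive_pos_increasing _ _ _ convex_dom_01 stirling2_mean_derive stirling2_mean_derive_pos).
Qed.

(** The exponential generating function of the Eulerian polynomials has its nearest pole at
    [- ln x / (1 - x)]; the inverse of this pole is the growth rate of the polynomials divided by
    [n!]. *)
Definition euler_rate (x : R) : R := ln ((1 - x) / - ln x).
Definition euler_mean (x : R) : R := x / (x - 1) - / ln x.

Lemma ln_neg (x : R) : 0 < x < 1 -> ln x < 0.
Proof. intros Hx; rewrite <- ln_1; apply ln_increasing; lra. Qed.

Lemma euler_mean_derive (x : R) :
  0 < x < 1 -> is_derive euler_mean x (/ (x * ln x ^ 2) - / (1 - x) ^ 2).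
Proof.
intros Hx; assert (H := ln_neg x Hx); unfold euler_mean.
auto_derive; [lra|unfold Rminus; field; lra].
Qed.

(** The geometric mean of 1 and [x], written [exp (ln x / 2)], is below their logarithmic mean
    [(1 - x) / - ln x]. This is [exp_sinh_lt] at [- ln x], multiplied by [x]. *)
Lemma sqrt_mul_ln_lt (x : R) : 0 < x < 1 -> - ln x * exp (ln x / 2) < 1 - x.
Proof.
intros Hx; assert (H := ln_neg x Hx).
assert (Hs := exp_sinh_lt (- ln x) ltac:(lra)).
apply (Rmult_lt_compat_r (exp (ln x)) _ _ (exp_pos _)) in Hs.
rewrite Rmult_minus_distr_r, Rmult_assoc, <- !exp_plus, Rplus_opp_l, exp_0 in Hs.
replace (- ln x / 2 + ln x) with (ln x / 2) in Hs by field.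
rewrite exp_ln in Hs by lra. lra.
Qed.

Lemma euler_mean_derive_pos (x : R) :
  0 < x < 1 -> 0 < / (x * ln x ^ 2) - / (1 - x) ^ 2.
Proof.
intros Hx; assert (H := ln_neg x Hx).
assert (Hs := sqrt_mul_ln_lt x Hx).
assert (He : exp (ln x / 2) * exp (ln x / 2) = x).
{ rewrite <- exp_plus. replace (ln x / 2 + ln x / 2) with (ln x) by field.
  apply exp_ln; lra. }
assert (He0 := exp_pos (ln x / 2)).
apply Rlt_0_minus, Rinv_lt_contravar.
- apply Rmult_lt_0_compat; [apply Rmult_lt_0_compat|]; try nra.
- assert (0 < - ln x * exp (ln x / 2)) by nra.
  replace (x * ln x ^ 2) with ((- ln x * exp (ln x / 2)) ^ 2); [nra|].
  replace ((- ln x * exp (ln x / 2)) ^ 2)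
    with (ln x ^ 2 * (exp (ln x / 2) * exp (ln x / 2))) by ring.
  rewrite He; ring.
Qed.

(** On [0 < x < 1] the mean increases from 0 to [1 / 2]; larger [kappa] are treated by symmetry
    later. *)
Lemma euler_mean_surj (kappa : R) :
  0 < kappa < 1 / 2 -> exists x, (0 < x < 1) /\ euler_mean x = kappa.
Proof.
intros Hk.
assert (Hexp : forall y, 0 < y -> 0 < exp (- y) < 1).
{ intros y Hy. assert (exp (- y) < exp 0) by (apply exp_increasing; lra).
  rewrite exp_0 in H. generalize (exp_pos (- y)); lra. }
assert (Hik : 2 < / kappa).
{ replace 2 with (/ (1 / 2)) by field. apply Rinv_lt_contravar; nra. }
assert (Ha := Hexp (/ kappa) ltac:(lra)).
(* At [exp (- t)] the mean is [/ t - / (exp t - 1)], which exceeds [/ t - / (t * (1 + t / 2)) = / (t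
   + 2) = kappa]. *)
set (t := / kappa - 2). assert (Ht : 0 < t) by (unfold t; lra).
assert (Hb := Hexp t Ht).
apply (increasing_ivt _ euler_mean _ _ _ kappa convex_dom_01 euler_mean_derive euler_mean_derive_pos
         Ha Hb).
unfold euler_mean; rewrite !ln_exp; split.
- replace (/ - / kappa) with (- kappa) by (field; lra).
  set (a := exp (- / kappa)) in *.
  assert (0 < a / (1 - a)) by (apply Rdiv_lt_0_compat; lra).
  replace (a / (a - 1)) with (- (a / (1 - a))) by (field; lra). lra.
- assert (Het : t * (1 + t / 2) < exp t - 1).
  { eapply Rlt_trans; [|apply exp_sinh_lt, Ht].
    apply Rmult_lt_compat_l; [exact Ht|]. apply exp_ineq1; lra. }
  rewrite exp_Ropp.
  assert (Het0 : 0 < exp t - 1) by nra.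
  replace (/ exp t / (/ exp t - 1) - / - t) with (/ t - / (exp t - 1)).
  2: { field; repeat split; try lra; generalize (exp_pos t); lra. }
  assert (/ (exp t - 1) < / (t * (1 + t / 2))).
  { apply Rinv_lt_contravar; [|exact Het]. apply Rmult_lt_0_compat; nra. }
  replace kappa with (/ t - / (t * (1 + t / 2))); [lra|].
  unfold t. field. lra.
Qed.

Lemma euler_rate_strict (kappa x0 x : R) :
  0 < x0 < 1 -> euler_mean x0 = kappa -> 0 < x < 1 -> x <> x0 ->
  kappa * ln (x / x0) < euler_rate x - euler_rate x0.
Proof.
intros H0 Hk Hx Hne.
enough (euler_rate x0 - kappa * ln x0 < euler_rate x - kappa * ln x)
  by (rewrite ln_div by lra; lra).
apply (sign_change_strict_min _ (fun t => euler_rate t - kappa * ln t) (fun t => / t) euler_mean x0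
   convex_dom_01); try assumption.
- intros y Hy. assert (H := ln_neg y Hy). unfold euler_rate; rewrite Hk; unfold euler_mean.
  auto_derive.
  + repeat split; try lra. apply Rdiv_lt_0_compat; lra.
  + unfold Rminus; field; lra.
- intros y Hy; apply Rinv_0_lt_compat; lra.
- apply (is_derive_pos_increasing _ _ _ convex_dom_01 euler_mean_derive euler_mean_derive_pos).
Qed.

(** The strict minimum property at the boundary point [x0 = 1], for [kappa = 1 / 2]; the limit of
    [euler_rate] at 1 is 0. *)
Lemma euler_rate_gt_half (x : R) : 0 < x < 1 -> 1 / 2 * ln x < euler_rate x.
Proof.
intros Hx; assert (H := ln_neg x Hx); assert (Hs := sqrt_mul_ln_lt x Hx).
unfold euler_rate. rewrite <- (ln_exp (1 / 2 * ln x)).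
apply ln_increasing; [apply exp_pos|].
replace (1 / 2 * ln x) with (ln x / 2) by field.
apply Rmult_lt_reg_l with (- ln x); [lra|].
replace (- ln x * ((1 - x) / - ln x)) with (1 - x) by (field; lra). exact Hs.
Qed.

(** * Pascal and Stirling triangles *)

Definition tri (c : triangle_case) (n k : nat) : R :=
  INR (Defs.triangle (coef_a c) (coef_b c) n k).

Definition shift (u : nat -> R) (k : nat) : R :=
  match k with O => 0 | S k' => u k' end.

Lemma tri_pos (c : triangle_case) (n k : nat) : 0 <= tri c n k.
Proof. apply pos_INR. Qed.

Lemma tri_gt (c : triangle_case) (n k : nat) : (n < k)%nat -> tri c n k = 0.
Proof. intros H; unfold tri; rewrite triangle_gt by exact H; reflexivity. Qed.

Lemma tri_S (c : triangle_case) (n k : nat) :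
  tri c (S n) k = INR (coef_a c (S n) k) * shift (tri c n) k + INR (coef_b c (S n) k) * tri c n k.
Proof.
unfold tri; cbn [Defs.triangle]. rewrite plus_INR, !mult_INR.
destruct k; simpl; ring.
Qed.

Lemma p1_S (c : triangle_case) (n k : nat) :
  p1 (coef_a c) (coef_b c) (S n) (S k)
  = INR (coef_a c (S n) (S k)) * tri c n k / tri c (S n) (S k).
Proof. reflexivity. Qed.

Lemma shift_pos (u : nat -> R) (k : nat) : (forall j, 0 <= u j) -> 0 <= shift u k.
Proof. intros Hu; destruct k; simpl; [lra|apply Hu]. Qed.

Lemma sum_shift (u phi : nat -> R) (n : nat) :
  sum_f_R0 (fun k => shift u k * phi k) (S n) = sum_f_R0 (fun k => u k * phi (S k)) n.
Proof. rewrite decomp_sum by lia; simpl; ring. Qed.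

(** The two-by-two minors that occur when products of entries of the next row are expanded; [shift]
    supplies the zero in column [-1]. *)
Lemma log_concave_neighbours (u : nat -> R) (p q : nat) :
  log_concave u -> (forall k, 0 <= u k) -> (p <= q)%nat ->
  shift u p * u (S q) <= u p * u q /\
  shift u p * u (S (S q)) <= u p * u (S q) /\
  u p * u (S (S q)) <= u (S p) * u (S q) /\
  u p * u (S q) <= u (S p) * u q.
Proof.
intros Hu Hpos Hpq.
assert (H0 : forall j k, 0 <= u j * u k) by (intros; apply Rmult_le_pos; apply Hpos).
repeat split; try (apply Hu; lia).
- destruct p as [|p]; simpl; [rewrite Rmult_0_l; apply H0|apply Hu; lia].
- destruct p as [|p]; simpl; [rewrite Rmult_0_l; apply H0|apply Hu; lia].
Qed.

(** * Binomial coefficients *)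

Lemma pascal_S (n k : nat) :
  tri Pascal (S n) (S k) = tri Pascal n k + tri Pascal n (S k).
Proof. rewrite tri_S; simpl; ring. Qed.

Lemma pascal_0 (n : nat) : tri Pascal n 0 = 1.
Proof.
induction n as [|n IH]; [reflexivity|]. rewrite tri_S, IH; simpl; ring.
Qed.

Lemma pascal_absorb (n k : nat) :
  INR (S k) * tri Pascal (S n) (S k) = INR (S n) * tri Pascal n k.
Proof.
revert k; induction n as [|n IH]; intros k.
- rewrite pascal_S, (tri_gt Pascal 0 (S k)) by lia.
  destruct k; [simpl; ring|rewrite tri_gt by lia; ring].
- rewrite pascal_S, Rmult_plus_distr_l, IH.
  destruct k as [|k].
  + rewrite !pascal_0. rewrite !S_INR; simpl; ring.
  + specialize (IH k). rewrite pascal_S in IH |- *.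
    rewrite !S_INR in *. lra.
Qed.

Lemma pascal_absorb_upper (n k : nat) :
  INR (S k) * tri Pascal n (S k) = (INR n - INR k) * tri Pascal n k.
Proof.
generalize (pascal_absorb n k); rewrite pascal_S, !S_INR; lra.
Qed.

Lemma pascal_pos (n k : nat) : (k <= n)%nat -> 0 < tri Pascal n k.
Proof.
revert k; induction n as [|n IH]; intros k Hk.
- replace k with O by lia; rewrite pascal_0; lra.
- destruct k as [|k]; [rewrite pascal_0; lra|].
  rewrite pascal_S; generalize (IH k ltac:(lia)) (tri_pos Pascal n (S k)); lra.
Qed.

(** * Stirling numbers of the first kind, by rows *)

Lemma stirling1_S (n k : nat) :
  tri Stirling1 (S n) k = shift (tri Stirling1 n) k + INR n * tri Stirling1 n k.
Proof.
rewrite tri_S; cbn [coef_a coef_b]. rewrite Nat.sub_succ, Nat.sub_0_r. simpl; ring.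
Qed.

(** The generating function is multiplied by [x + c]. The required inequality holds separately for
    the coefficients of [1], [c] and [c * c]. *)
Lemma log_concave_linear_factor (u v : nat -> R) (c : R) :
  log_concave u -> (forall k, 0 <= u k) -> 0 <= c ->
  (forall k, v k = shift u k + c * u k) -> log_concave v.
Proof.
intros Hu Hpos Hc Hv p q Hpq; rewrite !Hv; simpl shift.
destruct (Nat.eq_dec p q) as [->|Hne]; [lra|].
destruct q as [|q]; [lia|]; simpl shift.
destruct (log_concave_neighbours u p q Hu Hpos ltac:(lia)) as [H1 [H2 [H3 H4]]].
generalize (Rmult_le_compat_l c _ _ Hc H2) (Rmult_le_compat_l c _ _ Hc H4)
  (Rmult_le_compat_l (c * c) _ _ (Rmult_le_pos _ _ Hc Hc) H3). lra.
Qed.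

Lemma stirling1_log_concave (n : nat) : log_concave (tri Stirling1 n).
Proof.
induction n as [|n IH].
- intros p q Hpq. rewrite (tri_gt Stirling1 0 (S p)), (tri_gt Stirling1 0 (S q)) by lia. lra.
- apply (log_concave_linear_factor (tri Stirling1 n) _ (INR n)); try assumption.
  + apply tri_pos.
  + apply pos_INR.
  + apply stirling1_S.
Qed.

Lemma stirling1_pos (n k : nat) : (k < n)%nat -> 0 < tri Stirling1 n (S k).
Proof.
revert k; induction n as [|n IH]; intros k Hk; [lia|].
rewrite stirling1_S; simpl shift.
assert (H0 : 0 <= INR n * tri Stirling1 n (S k))
  by (apply Rmult_le_pos; [apply pos_INR|apply tri_pos]).
destruct k as [|k].
- destruct n as [|n]; [unfold tri; simpl; lra|].
  generalize (tri_pos Stirling1 (S n) 0) (Rmult_lt_0_compat (INR (S n)) _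
    ltac:(apply lt_0_INR; lia) (IH O ltac:(lia))). lra.
- generalize (IH k ltac:(lia)); lra.
Qed.

Definition stirling1_sum (n : nat) (x : R) : R :=
  sum_f_R0 (fun k => tri Stirling1 n k * x ^ k) n.

Lemma stirling1_sum_S (n : nat) (x : R) :
  stirling1_sum (S n) x = (x + INR n) * stirling1_sum n x.
Proof.
unfold stirling1_sum.
rewrite (sum_eq _ (fun k => shift (tri Stirling1 n) k * x ^ k
                            + INR n * (tri Stirling1 n k * x ^ k)))
  by (intros; rewrite stirling1_S; ring).
rewrite sum_plus, sum_shift.
rewrite (sum_eq _ (fun k => tri Stirling1 n k * x ^ k * x)) by (intros; simpl; ring).
rewrite <- scal_sum.
rewrite (sum_eq (fun k => INR n * _) (fun k => tri Stirling1 n k * x ^ k * INR n))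
  by (intros; ring).
rewrite <- scal_sum, tech5, (tri_gt _ n (S n)) by lia. ring.
Qed.

(** The sum is [x (x + 1) ... (x + n - 1)]. Each [ln (x + j)] is compared with the integral of [ln]
    over an adjacent unit interval, by tangents of [xlnx]; the lower bound loses only the factor
    [x / (x + n)]. *)
Lemma stirling1_sum_bounds (n : nat) (x : R) :
  0 < x ->
  exp (xlnx (x + INR n) - xlnx x) * x <= stirling1_sum n x * (x + INR n) /\
  stirling1_sum n x <= exp (xlnx (x + INR n) - xlnx x).
Proof.
intros Hx.
induction n as [|n [IH1 IH2]].
- unfold stirling1_sum; simpl. rewrite Rplus_0_r, Rminus_diag, exp_0.
  unfold tri; simpl; lra.
- rewrite stirling1_sum_S, S_INR.
  assert (Hn := pos_INR n). set (y := x + INR n) in *.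
  replace (x + (INR n + 1)) with (y + 1) by (unfold y; ring).
  assert (Hy : 0 < y) by (unfold y; lra).
  assert (H1 := xlnx_tangent y (y + 1) Hy ltac:(lra)).
  assert (H2 := xlnx_tangent (y + 1) y ltac:(lra) Hy).
  replace (y + 1 - y) with 1 in H1 by ring.
  replace (y - (y + 1)) with (-1) in H2 by ring.
  split.
  + apply Rle_trans with (exp (xlnx y - xlnx x) * x * (y + 1)).
    * replace (exp (xlnx y - xlnx x) * x * (y + 1))
        with (exp (xlnx y - xlnx x) * exp (ln (y + 1)) * x)
        by (rewrite exp_ln by lra; ring).
      apply Rmult_le_compat_r; [lra|]. rewrite <- exp_plus.
      apply exp_le_exp; lra.
    * replace (y * stirling1_sum n x * (y + 1))
        with (stirling1_sum n x * y * (y + 1)) by ring.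
      apply Rmult_le_compat_r; lra.
  + apply Rle_trans with (y * exp (xlnx y - xlnx x)).
    * apply Rmult_le_compat_l; lra.
    * rewrite <- (exp_ln y) at 1 by exact Hy. rewrite <- exp_plus.
      apply exp_le_exp; lra.
Qed.

(** [v] is the Cauchy product of [u] with the powers of [c]. Its partial sums increase and stay
    below [U / (1 - c)], and their limit solves [L = U + c * L]. *)
Lemma is_series_geometric_conv (u v : nat -> R) (c U : R) :
  (forall r, 0 <= u r) -> (forall r, 0 <= v r) -> 0 <= c < 1 ->
  v O = u O -> (forall r, v (S r) = u (S r) + c * v r) ->
  is_series u U -> is_series v (U / (1 - c)).
Proof.
intros Hu Hv Hc H0 HS HU.
assert (Hsum : forall n, sum_n v (S n) = sum_n u (S n) + c * sum_n v n).
{ intros n; rewrite !sum_n_Reals; induction n as [|n IH].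
  - simpl; rewrite HS, H0; ring.
  - rewrite (tech5 v (S n)), (tech5 u (S n)), HS.
    assert (E : c * sum_f_R0 v (S n) = c * sum_f_R0 v n + c * v (S n))
      by (rewrite tech5; ring).
    lra. }
assert (HUn : forall n, sum_n u n <= U).
{ intros n. apply (is_lim_seq_incr_compare (sum_n u) U HU).
  intros k; rewrite sum_Sn; unfold plus; simpl; generalize (Hu (S k)); lra. }
assert (HB : forall n, sum_n v n <= U / (1 - c)).
{ assert (E : U / (1 - c) = U + c * (U / (1 - c))) by (field; lra).
  assert (HU0 : 0 <= U).
  { generalize (HUn O) (Hu O); rewrite sum_O; lra. }
  assert (0 <= c * (U / (1 - c))).
  { apply Rmult_le_pos; [lra|]. apply Rmult_le_pos; [lra|].
    apply Rlt_le, Rinv_0_lt_compat; lra. }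
  induction n as [|n IH].
  - generalize (HUn O); rewrite !sum_O, H0; lra.
  - rewrite Hsum, E. generalize (HUn (S n)) (Rmult_le_compat_l c _ _ (proj1 Hc) IH); lra. }
destruct (ex_finite_lim_seq_incr (sum_n v) (U / (1 - c))) as [L HL].
{ intros k; rewrite sum_Sn; unfold plus; simpl; generalize (Hv (S k)); lra. }
{ exact HB. }
assert (E : L = U + c * L).
{ apply is_lim_seq_incr_1 in HL as HL1.
  apply is_lim_seq_unique in HL1.
  assert (H : is_lim_seq (fun n => sum_n v (S n)) (U + c * L)).
  { apply is_lim_seq_ext with (fun n => sum_n u (S n) + c * sum_n v n).
    - intros n; symmetry; apply Hsum.
    - apply is_lim_seq_plus'.
      + apply (is_lim_seq_incr_1 (sum_n u)), HU.
      + apply (is_lim_seq_scal_l _ c L), HL. }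
  apply is_lim_seq_unique in H. rewrite HL1 in H. now injection H. }
replace (U / (1 - c)) with L; [exact HL|].
apply Rmult_eq_reg_r with (1 - c); [|lra]. field_simplify; lra.
Qed.

Lemma is_series_term_le (u : nat -> R) (U : R) (r : nat) :
  (forall k, 0 <= u k) -> is_series u U -> u r <= U.
Proof.
intros Hu HU.
assert (Hinc : forall k, sum_n u k <= sum_n u (S k)).
{ intros k; rewrite sum_Sn; unfold plus; simpl; generalize (Hu (S k)); lra. }
apply Rle_trans with (sum_n u r); [|apply (is_lim_seq_incr_compare _ _ HU Hinc)].
destruct r as [|r]; [rewrite sum_O; lra|].
rewrite sum_Sn; unfold plus; simpl.
assert (0 <= sum_n u r); [|lra].
induction r as [|r IH]; [rewrite sum_O; apply Hu|].
generalize (Hinc r); lra.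
Qed.

(* [column c k r] is [T(r + k, k)]: columns are indexed from the diagonal. *)
Definition column (c : triangle_case) (k r : nat) : R := tri c (r + k) k.

Lemma pascal_column_series (n : nat) (y : R) :
  0 <= y < 1 ->
  is_series (fun r => column Pascal n r * y ^ r) (/ (1 - y) ^ S n).
Proof.
intros Hy.
assert (Hpos : forall k r, 0 <= column Pascal k r * y ^ r).
{ intros k r; apply Rmult_le_pos; [apply tri_pos|apply pow_le; lra]. }
induction n as [|n IH].
- apply is_series_ext with (fun r => y ^ r).
  { intros r; unfold column; rewrite pascal_0; symmetry; apply Rmult_1_l. }
  replace (/ (1 - y) ^ 1) with (/ (1 - y)) by (f_equal; ring).
  apply is_series_geom. rewrite Rabs_pos_eq; lra.
- replace (/ (1 - y) ^ S (S n)) with (/ (1 - y) ^ S n / (1 - y)).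
  2: { unfold Rdiv; rewrite <- Rinv_mult; f_equal; simpl; ring. }
  apply (is_series_geometric_conv (fun r => column Pascal n r * y ^ r)); try assumption; try apply Hpos.
  + unfold column; simpl Nat.add. rewrite pascal_S, (tri_gt _ n (S n)) by lia. ring.
  + intros r; unfold column; cbv beta.
    rewrite !Nat.add_succ_r, !Nat.add_succ_l, pascal_S. simpl; ring.
Qed.

(** * Stirling numbers of the second kind, by columns *)

Lemma stirling2_column_0 (k : nat) : column Stirling2 (S k) 0 = column Stirling2 k 0.
Proof.
unfold column; simpl Nat.add. rewrite tri_S, (tri_gt _ k (S k)) by lia. simpl; ring.
Qed.

Lemma stirling2_column_S (k r : nat) :
  column Stirling2 (S k) (S r)
  = column Stirling2 k (S r) + INR (S k) * column Stirling2 (S k) r.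
Proof.
unfold column; simpl Nat.add. rewrite <- plus_n_Sm, tri_S.
cbn [coef_a coef_b shift]. change (INR 1) with 1. ring.
Qed.

Lemma stirling2_column_0_S (r : nat) : column Stirling2 0 (S r) = 0.
Proof. unfold column. rewrite Nat.add_0_r, tri_S; simpl; ring. Qed.

Lemma stirling2_column_1 (r : nat) : column Stirling2 1 r = 1.
Proof.
induction r as [|r IH].
- rewrite stirling2_column_0; reflexivity.
- rewrite stirling2_column_S, IH.
  rewrite stirling2_column_0_S; simpl; ring.
Qed.

Lemma stirling2_column_pos (k r : nat) : 0 < column Stirling2 (S k) r.
Proof.
revert r; induction k as [|k IH]; intros r.
- rewrite stirling2_column_1; lra.
- induction r as [|r IHr]; [rewrite stirling2_column_0; apply IH|].
  rewrite stirling2_column_S.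
  apply Rplus_lt_0_compat; [apply IH|].
  apply Rmult_lt_0_compat; [apply lt_0_INR; lia|exact IHr].
Qed.

(** The generating function is divided by [1 - c * x]. *)
Lemma log_concave_geometric_conv (u v : nat -> R) (c : R) :
  log_concave u -> (forall r, 0 < u r) -> (forall r, 0 < v r) -> 0 <= c ->
  v O = u O -> (forall r, v (S r) = u (S r) + c * v r) -> log_concave v.
Proof.
intros Hu Hu0 Hv0 Hc H0 HS.
(* After insertion of the recursion the terms [c * v p * v q] cancel, and this mixed inequality is
   what remains. *)
assert (H : forall p q, (p <= q)%nat -> v p * u (S q) <= u (S p) * v q).
{ induction p as [|p IH]; intros q Hpq.
  - rewrite H0. apply Rle_trans with (u 1%nat * u q); [apply Hu; lia|].
    apply Rmult_le_compat_l; [apply Rlt_le, Hu0|].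
    destruct q as [|q]; [rewrite H0; lra|].
    rewrite HS; generalize (Rmult_le_pos _ _ Hc (Rlt_le _ _ (Hv0 q))); lra.
  - destruct q as [|q]; [lia|]. rewrite (HS p), (HS q).
    assert (H1 : u (S p) * u (S (S q)) <= u (S (S p)) * u (S q)) by (apply Hu; lia).
    assert (H2 : v p * u (S q) <= u (S p) * v q) by (apply IH; lia).
    (* The product of [H1] and [H2], with the positive factor [u (S p) * u (S q)] cancelled. *)
    assert (H3 : v p * u (S (S q)) <= u (S (S p)) * v q).
    { apply Rmult_le_reg_r with (u (S p) * u (S q));
        [apply Rmult_lt_0_compat; apply Hu0|].
      assert (H4 := Rmult_le_compat _ _ _ _
        (Rmult_le_pos _ _ (Rlt_le _ _ (Hv0 p)) (Rlt_le _ _ (Hu0 (S q))))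
        (Rmult_le_pos _ _ (Rlt_le _ _ (Hu0 (S p))) (Rlt_le _ _ (Hu0 (S (S q))))) H2 H1).
      lra. }
    generalize (Rmult_le_compat_l c _ _ Hc H3). lra. }
intros p q Hpq. rewrite !HS. generalize (H p q Hpq). lra.
Qed.

Lemma stirling2_column_log_concave (k : nat) : log_concave (column Stirling2 k).
Proof.
destruct k as [|k].
{ intros p q _; rewrite !stirling2_column_0_S; lra. }
(* The induction starts at column 1, which is constant; column 0 is [1, 0, 0, ...] and so not
   positive. *)
induction k as [|k IH].
- intros p q _; rewrite !stirling2_column_1; lra.
- apply (log_concave_geometric_conv (column Stirling2 (S k)) _ (INR (S (S k)))); try assumption.
  + apply stirling2_column_pos.
  + apply stirling2_column_pos.
  + apply pos_INR.
  + apply stirling2_column_0.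
  + apply stirling2_column_S.
Qed.

(** [P] is the product of the [/ (1 - j * z)] for [1 <= j <= k]. The exponent is the integral of
    [- ln (1 - s * z)] over [0 <= s <= k]; it bounds the sum of logarithms from below, and adding
    the last summand bounds it from above. *)
Lemma stirling2_column_series (k : nat) (z : R) :
  0 < z -> INR k * z < 1 ->
  exists P, is_series (fun r => column Stirling2 k r * z ^ r) P /\
    exp ((xlnx (1 - INR k * z) + 1) / z) <= P
    <= exp ((xlnx (1 - INR k * z) + 1) / z) / (1 - INR k * z).
Proof.
intros Hz.
assert (Hpos : forall k r, 0 <= column Stirling2 k r * z ^ r).
{ intros j r; apply Rmult_le_pos; [apply tri_pos|apply pow_le; lra]. }
induction k as [|k IH]; intros Hk.
- exists 1. split.
  + assert (E : forall n, sum_n (fun r => column Stirling2 0 r * z ^ r) n = 1).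
    { induction n as [|n IH]; [rewrite sum_O; unfold column, tri; simpl; ring|].
      rewrite sum_Sn, IH. unfold column.
      rewrite Nat.add_0_r, tri_S. unfold plus; simpl. ring. }
    apply (is_lim_seq_ext (fun _ => 1) _ 1); [intros n; symmetry; apply E|].
    apply is_lim_seq_const.
  + simpl INR. unfold xlnx. rewrite Rmult_0_l, Rminus_0_r, ln_1.
    replace ((1 * 0 - 1 + 1) / z) with 0 by (field; lra). rewrite exp_0; lra.
- rewrite S_INR in Hk |- *.
  destruct IH as [P [HP [H1 H2]]]; [lra|].
  set (y := 1 - INR k * z) in *.
  replace (1 - (INR k + 1) * z) with (y - z) by (unfold y; ring).
  assert (Hy : z < y) by (unfold y; lra).
  exists (P / (y - z)). split.
  + replace (y - z) with (1 - INR (S k) * z) by (rewrite S_INR; unfold y; ring).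
    apply (is_series_geometric_conv (fun r => column Stirling2 k r * z ^ r)); try assumption; try apply Hpos.
    * rewrite S_INR; split; [|lra].
      apply Rmult_le_pos; [generalize (pos_INR k); lra|lra].
    * rewrite stirling2_column_0; reflexivity.
    * intros r; rewrite stirling2_column_S; simpl pow; ring.
  + assert (T1 := xlnx_tangent (y - z) y ltac:(lra) ltac:(lra)).
    assert (T2 := xlnx_tangent y (y - z) ltac:(lra) ltac:(lra)).
    assert (Hiz : 0 < / z) by (apply Rinv_0_lt_compat, Hz).
    apply (Rmult_le_compat_r (/ z)) in T1; [|lra].
    apply (Rmult_le_compat_r (/ z)) in T2; [|lra].
    replace ((xlnx (y - z) + (y - (y - z)) * ln (y - z)) * / z)
      with (xlnx (y - z) / z + ln (y - z)) in T1 by (field; lra).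
    replace ((xlnx y + (y - z - y) * ln y) * / z)
      with (xlnx y / z - ln y) in T2 by (field; lra).
    assert (E1 : (xlnx (y - z) + 1) / z <= (xlnx y + 1) / z - ln (y - z)).
    { unfold Rdiv in *; lra. }
    assert (E2 : (xlnx y + 1) / z - ln y <= (xlnx (y - z) + 1) / z).
    { unfold Rdiv in *; lra. }
    apply exp_le_exp in E1. apply exp_le_exp in E2.
    unfold Rminus in E1 at 2, E2 at 1. rewrite exp_plus, exp_Ropp, exp_ln in E1 by lra.
    rewrite exp_plus, exp_Ropp, exp_ln in E2 by lra.
    assert (Hi : 0 < / (y - z)) by (apply Rinv_0_lt_compat; lra).
    split.
    * eapply Rle_trans; [exact E1|]. apply Rmult_le_compat_r; lra.
    * apply Rmult_le_compat_r; [lra|]. unfold Rdiv in H2. lra.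
Qed.

(** * The Eulerian triangle *)

Lemma euler_S (n k : nat) :
  tri Euler (S n) k
  = (INR (S n) - INR k) * shift (tri Euler n) k + (INR k + 1) * tri Euler n k.
Proof.
rewrite tri_S; cbn [coef_a coef_b]. rewrite plus_INR.
destruct (Nat.le_gt_cases k (S n)) as [Hk|Hk].
- rewrite minus_INR by exact Hk; reflexivity.
(* Here the truncated coefficient differs from the real one, but the entry it multiplies
   vanishes. *)
- destruct k as [|k]; [lia|]. simpl shift.
  rewrite (tri_gt Euler n k) by lia. simpl INR; ring.
Qed.

Lemma euler_diag (n k : nat) : (n < k)%nat -> tri Euler (S n) k = 0.
Proof.
intros Hk; destruct (Nat.eq_dec k (S n)) as [->|Hne]; [|apply tri_gt; lia].
rewrite euler_S, (tri_gt Euler n (S n)) by lia. ring.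
Qed.

Lemma euler_pos (n k : nat) : (k <= n)%nat -> 0 < tri Euler (S n) k.
Proof.
revert k; induction n as [|n IH]; intros k Hk.
- replace k with O by lia. rewrite euler_S; unfold tri; simpl; lra.
- rewrite euler_S, !S_INR.
  assert (Hk' := le_INR _ _ Hk); rewrite S_INR in Hk'.
  destruct (Nat.eq_dec k (S n)) as [->|Hne].
  + simpl shift. rewrite (euler_diag n (S n)), S_INR by lia.
    generalize (IH n ltac:(lia)); lra.
  + apply Rplus_le_lt_0_compat.
    * apply Rmult_le_pos; [lra|apply shift_pos; intros; apply tri_pos].
    * apply Rmult_lt_0_compat; [generalize (pos_INR k); lra|apply IH; lia].
Qed.

Lemma euler_log_concave (n : nat) : log_concave (tri Euler n).
Proof.
induction n as [|n IH].
{ intros p q Hpq. rewrite (tri_gt Euler 0 (S p)), (tri_gt Euler 0 (S q)) by lia. lra. }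
intros p q Hpq.
destruct (Nat.eq_dec p q) as [->|Hne]; [lra|].
destruct (Nat.le_gt_cases q n) as [Hq|Hq].
2: { rewrite (euler_diag n (S q)) by lia. rewrite Rmult_0_r.
     apply Rmult_le_pos; apply tri_pos. }
destruct q as [|q]; [lia|].
destruct (log_concave_neighbours _ p q IH (tri_pos Euler n) ltac:(lia)) as [H1 [H2 [H3 H4]]].
rewrite !euler_S; simpl shift.
assert (HP := pos_INR p).
assert (HPQ : INR p <= INR q) by (apply le_INR; lia).
assert (HQn := le_INR _ _ Hq).
rewrite !S_INR in *.
set (P := INR p) in *. set (Q := INR q) in *. set (N := INR n) in *.
set (al := shift (tri Euler n) p) in *.
assert (Hal : 0 <= al) by (apply shift_pos, tri_pos).
assert (Hbe := tri_pos Euler n p). assert (Hga := tri_pos Euler n (S p)).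
assert (Hde := tri_pos Euler n q). assert (Hep := tri_pos Euler n (S q)).
assert (Hze := tri_pos Euler n (S (S q))).
set (be := tri Euler n p) in *. set (ga := tri Euler n (S p)) in *.
set (de := tri Euler n q) in *. set (ep := tri Euler n (S q)) in *.
set (ze := tri Euler n (S (S q))) in *.
(* Once the four minors are used, [(Q + 1 - P) * (be * de + ga * ep - 2 * (be * ep))] is left. It is
   nonnegative by the inequality of arithmetic and geometric means, since [be * ep <= ga * de]. *)
assert (HAG : 2 * (be * ep) <= be * de + ga * ep).
{ assert (0 <= be * ep) by (apply Rmult_le_pos; assumption).
  assert (0 <= be * de) by (apply Rmult_le_pos; assumption).
  assert (0 <= ga * ep) by (apply Rmult_le_pos; assumption).
  assert ((be * ep) * (be * ep) <= (be * de) * (ga * ep)).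
  { replace ((be * de) * (ga * ep)) with ((be * ep) * (ga * de)) by ring.
    apply Rmult_le_compat_l; assumption. }
  apply Rsqr_incr_0_var; [unfold Rsqr|lra].
  generalize (Rle_0_sqr (be * de - ga * ep)); unfold Rsqr; nra. }
assert (M1 : 0 <= (N + 1 - P) * (N - 1 - Q)) by (apply Rmult_le_pos; lra).
assert (M2 : 0 <= (N + 1 - P) * (Q + 3)) by (apply Rmult_le_pos; lra).
assert (M3 : 0 <= (P + 1) * (Q + 3)) by (apply Rmult_le_pos; lra).
assert (M4 : 0 <= (P + 2) * (N - Q)) by (apply Rmult_le_pos; lra).
generalize (Rmult_le_compat_l _ _ _ M1 H1) (Rmult_le_compat_l _ _ _ M2 H2)
  (Rmult_le_compat_l _ _ _ M3 H3) (Rmult_le_compat_l _ _ _ M4 H4)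
  (Rmult_le_compat_l (Q + 1 - P) _ _ ltac:(lra) HAG).
lra.
Qed.

(** * Worpitzky's identity and the growth of the Eulerian rows *)

Lemma euler_sum_S (n : nat) (phi : nat -> R) :
  sum_f_R0 (fun k => tri Euler (S n) k * phi k) (S n)
  = sum_f_R0 (fun k => tri Euler n k
      * ((INR n - INR k) * phi (S k) + (INR k + 1) * phi k)) n.
Proof.
rewrite (sum_eq _ (fun k => shift (tri Euler n) k * ((INR (S n) - INR k) * phi k)
                            + tri Euler n k * ((INR k + 1) * phi k)))
  by (intros; rewrite euler_S; ring).
rewrite sum_plus, sum_shift, tech5, (tri_gt Euler n (S n)) by lia.
rewrite Rmult_0_l, Rplus_0_r, <- sum_plus.
apply sum_eq; intros k _; rewrite !S_INR; ring.
Qed.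

(** [euler_sum_S] moves the recursion onto the binomial coefficient; by absorption the result
    collapses to [INR j + 1] times the binomial coefficient of the previous row. *)
Lemma worpitzky (n j : nat) :
  sum_f_R0 (fun k => tri Euler n k * tri Pascal (j + n - k) n) n = (INR j + 1) ^ n.
Proof.
induction n as [|n IH].
- simpl. rewrite pascal_0; unfold tri; simpl; ring.
- rewrite euler_sum_S. simpl pow. rewrite <- IH, scal_sum.
  apply sum_eq; intros k Hk.
  replace (j + S n - S k)%nat with (j + n - k)%nat by lia.
  replace (j + S n - k)%nat with (S (j + n - k)) by lia.
  rewrite pascal_S.
  assert (H := pascal_absorb_upper (j + n - k) n).
  rewrite minus_INR, plus_INR, S_INR in H by lia.
  replace ((INR n - INR k) * tri Pascal (j + n - k) (S n) +
    (INR k + 1) * (tri Pascal (j + n - k) n + tri Pascal (j + n - k) (S n)))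
    with ((INR n + 1) * tri Pascal (j + n - k) (S n)
          + (INR k + 1) * tri Pascal (j + n - k) n) by ring.
  rewrite H; ring.
Qed.

Lemma term_le_sum (f : nat -> R) (n k : nat) :
  (forall i, 0 <= f i) -> (k <= n)%nat -> f k <= sum_f_R0 f n.
Proof.
intros Hf Hk; induction n as [|n IH].
- replace k with O by lia; simpl; lra.
- rewrite tech5. destruct (Nat.eq_dec k (S n)) as [->|Hne].
  + generalize (cond_pos_sum f n Hf); lra.
  + generalize (IH ltac:(lia)) (Hf (S n)); lra.
Qed.

Lemma euler_worpitzky_le (n k r : nat) :
  (k <= n)%nat -> tri Euler n k * column Pascal n r <= (INR (k + r) + 1) ^ n.
Proof.
intros Hk. rewrite <- worpitzky.
set (f := fun i => tri Euler n i * tri Pascal (k + r + n - i) n).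
replace (tri Euler n k * column Pascal n r) with (f k).
- apply term_le_sum; [|exact Hk].
  intros i; apply Rmult_le_pos; apply tri_pos.
- unfold f, column; do 2 f_equal; lia.
Qed.

(** The Eulerian polynomial divided by [(1 - x) ^ S n] is the series of the [(j + 1) ^ n * x ^ j];
    one term is kept. Termwise, after [worpitzky], this is a single term of the negative binomial
    series. *)
Lemma euler_sum_ge (n j : nat) (x : R) :
  0 < x < 1 ->
  (INR j + 1) ^ n * x ^ j * (1 - x) ^ S n
  <= sum_f_R0 (fun k => tri Euler n k * x ^ k) n.
Proof.
intros Hx. rewrite <- worpitzky, Rmult_assoc, (Rmult_comm (sum_f_R0 _ _)), scal_sum.
apply sum_Rle; intros k Hk.
rewrite Rmult_assoc. apply Rmult_le_compat_l; [apply tri_pos|].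
destruct (Nat.le_gt_cases k j) as [Hkj|Hkj].
- assert (Hser := pascal_column_series n x ltac:(lra)).
  apply (is_series_term_le _ _ (j - k)) in Hser.
  2: { intros r; apply Rmult_le_pos; [apply tri_pos|apply pow_le; lra]. }
  unfold column in Hser. replace (j - k + n)%nat with (j + n - k)%nat in Hser by lia.
  assert (Hp : 0 < (1 - x) ^ S n) by (apply pow_lt; lra).
  apply (Rmult_le_compat_r (x ^ k * (1 - x) ^ S n)) in Hser.
  2: { apply Rmult_le_pos; [apply pow_le|]; lra. }
  replace (x ^ j) with (x ^ (j - k) * x ^ k) by (rewrite <- pow_add; f_equal; lia).
  replace (/ (1 - x) ^ S n * (x ^ k * (1 - x) ^ S n)) with (x ^ k) in Hser
    by (field; lra).
  lra.
- rewrite tri_gt by lia. rewrite Rmult_0_l. apply pow_le; lra.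
Qed.

(* [y ^ n * x ^ y] over real [y > 0] is largest at [y = n / - ln x]. *)
Lemma pow_mul_exp_le (n : nat) (x y : R) :
  (0 < n)%nat -> 0 < x < 1 -> 0 < y ->
  y ^ n * exp (y * ln x) <= exp (INR n * (ln (INR n) - ln (- ln x) - 1)).
Proof.
intros Hn Hx Hy. apply lt_0_INR in Hn.
assert (H := ln_neg x Hx).
rewrite <- Rpower_pow by exact Hy. unfold Rpower. rewrite <- exp_plus.
apply exp_le_exp.
assert (Ht : 0 < - ln x * y / INR n).
{ apply Rdiv_lt_0_compat; [apply Rmult_lt_0_compat; lra|exact Hn]. }
assert (Hl := ln_le_sub_1 _ Ht).
rewrite ln_div, ln_mult in Hl by (try apply Rmult_lt_0_compat; lra).
apply (Rmult_le_compat_l (INR n)) in Hl; [|lra].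
replace (INR n * (- ln x * y / INR n - 1)) with (- ln x * y - INR n) in Hl by (field; lra).
lra.
Qed.

Lemma euler_sum_ge_exp (n : nat) (x : R) :
  (0 < n)%nat -> 0 < x < 1 ->
  exp (INR n * (euler_rate x + (ln (INR n) - 1)) - (- ln (1 - x)))
  <= sum_f_R0 (fun k => tri Euler n k * x ^ k) n.
Proof.
intros Hn Hx. assert (Hln := ln_neg x Hx).
assert (Hn' := lt_0_INR _ Hn).
set (y := INR n / - ln x).
assert (Hy : 0 < y) by (apply Rdiv_lt_0_compat; lra).
(* With [j <= y < j + 1], both [(j + 1) ^ n >= y ^ n] and [x ^ j >= x ^ y] hold, so rounding the
   maximiser [y] costs nothing. *)
destruct (nfloor_ex y (Rlt_le _ _ Hy)) as [j [Hj1 Hj2]].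
eapply Rle_trans; [|apply (euler_sum_ge n j x Hx)].
apply Rle_trans with (y ^ n * exp (y * ln x) * (1 - x) ^ S n).
- rewrite <- (Rpower_pow n y) by exact Hy.
  rewrite <- (Rpower_pow (S n) (1 - x)) by lra.
  unfold Rpower. rewrite <- !exp_plus. apply exp_le_exp.
  unfold euler_rate. unfold y at 1. rewrite !ln_div, S_INR by lra.
  replace (y * ln x) with (- INR n) by (unfold y; field; lra). lra.
- apply Rmult_le_compat_r; [apply pow_le; lra|].
  apply Rmult_le_compat.
  + apply pow_le; lra.
  + apply Rlt_le, exp_pos.
  + apply pow_incr; lra.
  + rewrite <- Rpower_pow by lra. unfold Rpower. apply exp_le_exp.
    generalize (Rmult_le_compat_neg_l (ln x) _ _ (Rlt_le _ _ Hln) Hj1). lra.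
Qed.

(** One term of [worpitzky] bounds the weight times [column Pascal n r * x ^ r] by [E / x], for
    every [r]. Summation against [s ^ r] gives the negative binomial series at [x * s] on the left
    and a convergent geometric series on the right; the price is [1 - x * s] in place of [1 - x]. *)
Lemma euler_term_le_exp (n k : nat) (x s : R) :
  (0 < n)%nat -> 0 < x < 1 -> 0 < s < 1 ->
  tri Euler n k * x ^ k
  <= exp (INR n * (ln (1 - x * s) - ln (- ln x) + (ln (INR n) - 1))
          + (- ln x - ln (1 - s))).
Proof.
intros Hn Hx Hs. assert (Hln := ln_neg x Hx).
destruct (Nat.le_gt_cases k n) as [Hk|Hk].
2: { rewrite tri_gt, Rmult_0_l by lia. apply Rlt_le, exp_pos. }
set (E := exp (INR n * (ln (INR n) - ln (- ln x) - 1))).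
assert (Hxs : 0 < x * s < 1).
{ split; [apply Rmult_lt_0_compat; lra|].
  apply Rlt_trans with (x * 1); [apply Rmult_lt_compat_l; lra|lra]. }
assert (Hser := pascal_column_series n (x * s) ltac:(lra)).
assert (Hgeo : is_series (fun r => s ^ r) (/ (1 - s))).
{ apply is_series_geom; rewrite Rabs_pos_eq; lra. }
assert (HpE : forall r, tri Euler n k * x ^ k * (column Pascal n r * x ^ r) <= E / x).
{ intros r.
  assert (Hy : 0 < INR (k + r) + 1) by (generalize (pos_INR (k + r)); lra).
  replace (tri Euler n k * x ^ k * (column Pascal n r * x ^ r))
    with (tri Euler n k * column Pascal n r * x ^ (k + r)) by (rewrite pow_add; ring).
  apply Rle_trans with ((INR (k + r) + 1) ^ n * x ^ (k + r)).
  - apply Rmult_le_compat_r; [apply pow_le; lra|apply euler_worpitzky_le, Hk].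
  - assert (Hm := pow_mul_exp_le n x _ Hn Hx Hy). fold E in Hm.
    apply (Rle_div_r _ _ x (proj1 Hx)).
    replace (x ^ (k + r)) with (exp (INR (k + r) * ln x))
      by (rewrite <- Rpower_pow by lra; reflexivity).
    replace ((INR (k + r) + 1) * ln x) with (INR (k + r) * ln x + ln x) in Hm by ring.
    rewrite exp_plus, (exp_ln x) in Hm by lra. lra. }
assert (Hle : tri Euler n k * x ^ k * / (1 - x * s) ^ S n <= E / x * / (1 - s)).
{ apply (is_lim_seq_le
    (sum_n (fun r => tri Euler n k * x ^ k * (column Pascal n r * (x * s) ^ r)))
    (sum_n (fun r => E / x * s ^ r))
    (tri Euler n k * x ^ k * / (1 - x * s) ^ S n) (E / x * / (1 - s))).
  - intros m; apply sum_n_m_le; intros r.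
    rewrite Rpow_mult_distr.
    replace (tri Euler n k * x ^ k * (column Pascal n r * (x ^ r * s ^ r)))
      with (tri Euler n k * x ^ k * (column Pascal n r * x ^ r) * s ^ r) by ring.
    apply Rmult_le_compat_r; [apply pow_le; lra|apply HpE].
  - apply (is_series_scal (tri Euler n k * x ^ k) _ _ Hser).
  - apply (is_series_scal (E / x) _ _ Hgeo). }
assert (Hp : 0 < (1 - x * s) ^ S n) by (apply pow_lt; lra).
apply Rle_trans with (E / x * / (1 - s) * (1 - x * s) ^ S n).
{ apply (Rmult_le_compat_r ((1 - x * s) ^ S n)) in Hle; [|lra].
  rewrite Rmult_assoc, Rinv_l, Rmult_1_r in Hle by lra. exact Hle. }
apply Rle_trans with (E / x * / (1 - s) * (1 - x * s) ^ n).
{ apply Rmult_le_compat_l.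
  - apply Rmult_le_pos; [apply Rmult_le_pos; [apply Rlt_le, exp_pos|]|];
      apply Rlt_le, Rinv_0_lt_compat; lra.
  - simpl. assert (0 < (1 - x * s) ^ n) by (apply pow_lt; lra).
    rewrite <- (Rmult_1_l ((1 - x * s) ^ n)) at 2. apply Rmult_le_compat_r; lra. }
rewrite <- (Rpower_pow n (1 - x * s)) by lra. unfold Rpower.
replace (/ (1 - s)) with (exp (- ln (1 - s))) by (rewrite exp_Ropp, exp_ln; lra).
unfold Rdiv. replace (/ x) with (exp (- ln x)) by (rewrite exp_Ropp, exp_ln; lra).
unfold E. rewrite <- !exp_plus. apply exp_le_exp. lra.
Qed.

(** The weight at [x = 1] is at most the row sum [n!]. The surplus [ln (n + 1)] is traded for
    [eps * n] plus a constant. *)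
Lemma euler_term_le_row (n k : nat) (eps : R) :
  (0 < n)%nat -> 0 < eps ->
  tri Euler n k <= exp (INR n * (eps + (ln (INR n) - 1)) + (1 + eps - ln eps)).
Proof.
intros Hn Heps. assert (Hn' := lt_0_INR _ Hn).
destruct (Nat.le_gt_cases k n) as [Hk|Hk].
2: { rewrite tri_gt by lia. apply Rlt_le, exp_pos. }
assert (Hrow : forall m, sum_f_R0 (fun k => tri Euler m k) m <= exp (xlnx (INR m + 1) + 1)).
{ induction m as [|m IH].
  - simpl. unfold xlnx, tri; simpl. rewrite Rplus_0_l, ln_1.
    replace (1 * 0 - 1 + 1) with 0 by ring. rewrite exp_0; lra.
  - rewrite (sum_eq _ (fun k => tri Euler (S m) k * 1)) by (intros; ring).
    rewrite (euler_sum_S m (fun _ => 1)).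
    rewrite (sum_eq _ (fun k => tri Euler m k * (INR m + 1))) by (intros; ring).
    rewrite <- scal_sum, S_INR.
    assert (Hm := pos_INR m).
    assert (T := xlnx_tangent (INR m + 1) (INR m + 1 + 1) ltac:(lra) ltac:(lra)).
    rewrite <- (exp_ln (INR m + 1)) at 1 by lra.
    apply Rle_trans with (exp (ln (INR m + 1)) * exp (xlnx (INR m + 1) + 1)).
    + apply Rmult_le_compat_l; [apply Rlt_le, exp_pos|exact IH].
    + rewrite <- exp_plus. apply exp_le_exp. lra. }
apply Rle_trans with (sum_f_R0 (fun k => tri Euler n k) n).
{ apply (term_le_sum (tri Euler n)); [apply tri_pos|exact Hk]. }
eapply Rle_trans; [apply Hrow|]. apply exp_le_exp.
set (N := INR n) in *.
assert (T := xlnx_tangent (N + 1) N ltac:(lra) Hn').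
assert (L := ln_le_sub_1 (eps * (N + 1)) ltac:(apply Rmult_lt_0_compat; lra)).
rewrite ln_mult in L by lra. unfold xlnx in *. lra.
Qed.

Lemma euler_sym (n k : nat) : (k <= n)%nat -> tri Euler (S n) k = tri Euler (S n) (n - k).
Proof.
revert k; induction n as [|n IH]; intros k Hk; [f_equal; lia|].
rewrite (euler_S (S n) k), (euler_S (S n) (S n - k)).
rewrite minus_INR by exact Hk. rewrite !S_INR.
destruct k as [|k].
- rewrite Nat.sub_0_r. simpl shift. rewrite (euler_diag n (S n)) by lia.
  rewrite (IH O), Nat.sub_0_r by lia. simpl INR; ring.
- rewrite Nat.sub_succ. simpl shift. rewrite (IH k) by lia.
  rewrite S_INR.
  destruct (Nat.eq_dec k n) as [->|Hne].
  + rewrite Nat.sub_diag, (euler_diag n (S n)) by lia. simpl; ring.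
  + rewrite (IH (S k)) by lia.
    replace (n - k)%nat with (S (n - S k)) by lia. simpl shift. ring.
Qed.

(** * Limits *)

(** The term [s i], common to both bounds, cancels. Taking [d] halfway between the two rates leaves
    a linear gap that absorbs [C0] and [C1]. *)
Lemma outgrows_of_exp_bounds (a : nat -> nat -> R) (N s : nat -> R)
    (kappa x0 x r0 r C0 C1 : R) :
  is_lim_seq N p_infty -> kappa * ln (x / x0) < r - r0 ->
  eventually (fun i =>
    (forall k, a i k * x0 ^ k <= exp (N i * (r0 + s i) + C0)) /\
    exists M, exp (N i * (r + s i) - C1) <= sum_f_R0 (fun k => a i k * x ^ k) M) ->
  outgrows a N kappa x0 x.
Proof.
intros HN Hr Hev.
set (d := (kappa * ln (x / x0) + (r - r0)) / 2).
exists d; split; [unfold d; lra|].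
assert (Hd : 0 < r - r0 - d) by (unfold d; lra).
generalize (filter_and _ _ Hev (is_lim_seq_p_infty_gt N ((C0 + C1) / (r - r0 - d)) HN)).
apply filter_imp; intros i [[H1 [M H2]] H3].
exists (exp (N i * (r0 + s i) + C0)), M; split; [exact H1|].
eapply Rle_trans; [|exact H2].
rewrite <- exp_plus. apply exp_le_exp.
apply (Rmult_lt_compat_r _ _ _ Hd) in H3.
unfold Rdiv in H3. rewrite Rmult_assoc, Rinv_l in H3 by lra. lra.
Qed.

Lemma log_concave_scale (u : nat -> R) (y : R) :
  log_concave u -> 0 <= y -> log_concave (fun k => u k * y ^ k).
Proof.
intros Hu Hy p q Hpq.
replace (u p * y ^ p * (u (S q) * y ^ S q)) with (u p * u (S q) * (y ^ p * y ^ S q)) by ring.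
replace (u (S p) * y ^ S p * (u q * y ^ q)) with (u (S p) * u q * (y ^ p * y ^ S q))
  by (simpl; ring).
apply Rmult_le_compat_r; [|apply Hu, Hpq].
apply Rmult_le_pos; apply pow_le, Hy.
Qed.

Lemma stirling1_sum_exp (n : nat) (t : R) :
  (0 < n)%nat -> 0 < t ->
  exp (INR n * (stirling1_rate t + (ln (INR n) - 1)) - (ln (t + 1) - ln t))
  <= stirling1_sum n (INR n * t)
  <= exp (INR n * (stirling1_rate t + (ln (INR n) - 1))).
Proof.
intros Hn Ht. apply lt_0_INR in Hn.
destruct (stirling1_sum_bounds n (INR n * t) ltac:(apply Rmult_lt_0_compat; lra)) as [H1 H2].
assert (E : xlnx (INR n * t + INR n) - xlnx (INR n * t)
            = INR n * (stirling1_rate t + (ln (INR n) - 1))).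
{ replace (INR n * t + INR n) with (INR n * (t + 1)) by ring.
  unfold xlnx, stirling1_rate. rewrite !ln_mult by lra. ring. }
rewrite E in H1, H2. split; [|exact H2].
replace (INR n * t + INR n) with (INR n * (t + 1)) in H1 by ring.
unfold Rminus at 1. rewrite exp_plus, Ropp_minus_distr, <- ln_div, exp_ln by
  (try apply Rdiv_lt_0_compat; lra).
apply Rmult_le_reg_r with (INR n * (t + 1)); [apply Rmult_lt_0_compat; lra|].
eapply Rle_trans; [|exact H1]. right; field; lra.
Qed.

Lemma is_lim_seq_div_pos_eventually (n k : nat -> nat) (kappa : R) :
  0 < kappa ->
  is_lim_seq (fun i => INR (n i)) p_infty ->
  is_lim_seq (fun i => INR (k i) / INR (n i)) kappa ->
  eventually (fun i => (0 < n i)%nat /\ (0 < k i)%nat).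
Proof.
intros Hk HN HJ.
generalize (filter_and _ _ (is_lim_seq_p_infty_gt _ 0 HN)
  (is_lim_seq_eventually_gt _ _ 0 HJ Hk)).
apply filter_imp; intros i [H1 H2]; split; apply INR_lt; [exact H1|].
apply (Rmult_lt_compat_r (INR (n i))) in H2; [|exact H1].
unfold Rdiv in H2; rewrite Rmult_0_l, Rmult_assoc, Rinv_l in H2 by lra. simpl; lra.
Qed.

Lemma is_lim_seq_div_lt_eventually (n k : nat -> nat) (kappa c : R) :
  kappa < c ->
  is_lim_seq (fun i => INR (n i)) p_infty ->
  is_lim_seq (fun i => INR (k i) / INR (n i)) kappa ->
  eventually (fun i => INR (k i) < c * INR (n i)).
Proof.
intros Hk HN HJ.
generalize (filter_and _ _ (is_lim_seq_p_infty_gt _ 0 HN)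
  (is_lim_seq_eventually_lt _ _ c HJ Hk)).
apply filter_imp; intros i [H1 H2].
apply (Rmult_lt_compat_r (INR (n i))) in H2; [|exact H1].
unfold Rdiv in H2; rewrite Rmult_assoc, Rinv_l in H2 by lra. lra.
Qed.

(** * Limits of ratios in the two Stirling triangles *)

Lemma stirling1_ratio (kappa : R) :
  0 < kappa < 1 -> exists t0, 0 < t0 /\ forall n k : nat -> nat,
    is_lim_seq (fun i => INR (n i)) p_infty ->
    is_lim_seq (fun i => INR (k i) / INR (n i)) kappa ->
    is_lim_seq (fun i => tri Stirling1 (n i) (k i)
                         / (INR (n i) * tri Stirling1 (n i) (S (k i)))) t0.
Proof.
intros Hk. destruct (stirling1_mean_surj kappa Hk) as [t0 [Ht0 Hmean]].
exists t0; split; [exact Ht0|]. intros n k HN HJ.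
(* This scaling puts [x = n * t], so that the minimiser [t0] does not depend on [n]. *)
set (a := fun i j => tri Stirling1 (n i) j * INR (n i) ^ j).
assert (Hev : eventually (fun i => (0 < n i)%nat /\ (0 < k i)%nat /\ (k i < n i)%nat)).
{ generalize (filter_and _ _ (is_lim_seq_div_pos_eventually n k kappa (proj1 Hk) HN HJ)
    (is_lim_seq_div_lt_eventually n k kappa 1 (proj2 Hk) HN HJ)).
  apply filter_imp; intros i [[H1 H2] H3]. repeat split; try assumption.
  apply INR_lt; lra. }
apply is_lim_seq_ext_loc with (fun i => a i (k i) / a i (S (k i))).
{ revert Hev; apply filter_imp; intros i [H1 [H2 H3]]. unfold a.
  assert (0 < tri Stirling1 (n i) (S (k i))) by (apply stirling1_pos; lia).
  assert (0 < INR (n i)) by (apply lt_0_INR; lia).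
  assert (0 < INR (n i) ^ k i) by (apply pow_lt; lra).
  simpl. field; lra. }
apply (ratio_is_lim a (fun i => INR (n i)) k kappa t0) with (e := 1); try assumption; try lra.
- intros i; apply log_concave_scale; [apply stirling1_log_concave|apply pos_INR].
- intros i j; apply Rmult_le_pos; [apply tri_pos|apply pow_le, pos_INR].
- revert Hev; apply filter_imp; intros i [H1 [H2 H3]]. unfold a.
  assert (0 < INR (n i)) by (apply lt_0_INR; lia).
  split; (apply Rmult_lt_0_compat; [|apply pow_lt; lra]).
  + replace (k i) with (S (k i - 1)) by lia. apply stirling1_pos; lia.
  + apply stirling1_pos; lia.
- intros t _ Ht Hne.
  apply (outgrows_of_exp_bounds a _ (fun i => ln (INR (n i)) - 1) kappa t0 t
           (stirling1_rate t0) (stirling1_rate t) 0 (ln (t + 1) - ln t) HN).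
  { apply stirling1_rate_strict; assumption. }
  revert Hev; apply filter_imp; intros i [H1 _].
  assert (Ha : forall t j, a i j * t ^ j = tri Stirling1 (n i) j * (INR (n i) * t) ^ j).
  { intros y j; unfold a. rewrite Rpow_mult_distr; ring. }
  split.
  + intros j. rewrite Ha, Rplus_0_r.
    eapply Rle_trans; [|apply (stirling1_sum_exp (n i) t0 H1 Ht0)].
    assert (Hp : 0 <= INR (n i) * t0) by (apply Rmult_le_pos; [apply pos_INR|lra]).
    assert (Hf : forall j, 0 <= tri Stirling1 (n i) j * (INR (n i) * t0) ^ j).
    { intros y; apply Rmult_le_pos; [apply tri_pos|apply pow_le, Hp]. }
    destruct (Nat.le_gt_cases j (n i)) as [Hj|Hj].
    * apply (term_le_sum (fun j => tri Stirling1 (n i) j * (INR (n i) * t0) ^ j)); assumption.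
    * rewrite tri_gt by exact Hj. rewrite Rmult_0_l. apply cond_pos_sum, Hf.
  + exists (n i). rewrite (sum_eq _ _ _ (fun j _ => Ha t j)).
    apply (stirling1_sum_exp (n i) t H1 Ht).
Qed.

Lemma stirling2_ratio (lambda : R) :
  0 < lambda -> exists t0, (0 < t0 < 1) /\ forall n j : nat -> nat,
    is_lim_seq (fun i => INR (n i)) p_infty ->
    is_lim_seq (fun i => INR (j i) / INR (n i)) lambda ->
    is_lim_seq (fun i => INR (n i) * column Stirling2 (n i) (j i)
                         / column Stirling2 (n i) (S (j i))) t0.
Proof.
intros Hl. destruct (stirling2_mean_surj lambda Hl) as [t0 [Ht0 Hmean]].
exists t0; split; [exact Ht0|]. intros n j HN HJ.
set (a := fun i r => column Stirling2 (n i) r * (/ INR (n i)) ^ r).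
assert (Hcol : forall i r, (0 < n i)%nat -> 0 < column Stirling2 (n i) r).
{ intros i r Hi. replace (n i) with (S (n i - 1)) by lia. apply stirling2_column_pos. }
assert (Hev : eventually (fun i => (0 < n i)%nat)).
{ generalize (is_lim_seq_div_pos_eventually n j lambda Hl HN HJ).
  apply filter_imp; tauto. }
(* Nonnegativity is needed for every [i]; at [n i = 0] it comes from the default [/ 0 = 0]. *)
assert (Hin : forall i, 0 <= / INR (n i)).
{ intros i. destruct (n i) as [|n']; [simpl; rewrite Rinv_0; lra|].
  apply Rlt_le, Rinv_0_lt_compat, lt_0_INR; lia. }
apply is_lim_seq_ext_loc with (fun i => a i (j i) / a i (S (j i))).
{ revert Hev; apply filter_imp; intros i H1. unfold a.
  assert (H2 := Hcol i (S (j i)) H1).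
  assert (H3 := lt_0_INR _ H1).
  assert (0 < (/ INR (n i)) ^ j i) by (apply pow_lt, Rinv_0_lt_compat; lra).
  simpl. field; lra. }
(* This radius keeps [t] in the interval from 0 to 1, where the column series converges. *)
apply (ratio_is_lim a (fun i => INR (n i)) j lambda t0) with (e := Rmin t0 (1 - t0));
  try assumption; try lra.
- intros i; apply log_concave_scale; [apply stirling2_column_log_concave|apply Hin].
- intros i r; apply Rmult_le_pos; [apply tri_pos|apply pow_le, Hin].
- revert Hev; apply filter_imp; intros i H1. unfold a.
  assert (H3 := lt_0_INR _ H1).
  split; (apply Rmult_lt_0_compat; [apply Hcol, H1|apply pow_lt, Rinv_0_lt_compat, H3]).
- apply Rmin_glb_lt; lra.
- intros t He Ht Hne.
  assert (Ht1 : 0 < t < 1).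
  { split; [exact Ht|]. generalize (Rmin_r t0 (1 - t0)).
    apply Rabs_lt_between in He; lra. }
  apply (outgrows_of_exp_bounds a _ (fun i => 0) lambda t0 t
           (stirling2_rate t0) (stirling2_rate t) (- ln (1 - t0)) 1 HN).
  { apply stirling2_rate_strict; assumption. }
  revert Hev; apply filter_imp; intros i H1. assert (H3 := lt_0_INR _ H1).
  assert (Hser : forall t, 0 < t < 1 -> exists P, is_series (fun r => a i r * t ^ r) P /\
            exp (INR (n i) * (stirling2_rate t + 0)) <= P
            <= exp (INR (n i) * (stirling2_rate t + 0) + - ln (1 - t))).
  { clear t He Ht Hne Ht1. intros t Ht.
    set (z := t / INR (n i)).
    assert (Hz : 0 < z) by (apply Rdiv_lt_0_compat; lra).
    assert (Hkz : INR (n i) * z = t) by (unfold z; field; lra).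
    destruct (stirling2_column_series (n i) z Hz ltac:(rewrite Hkz; lra)) as [P [HP HPb]].
    exists P; split.
    - apply is_series_ext with (2 := HP). intros r. unfold a, z, Rdiv.
      rewrite Rpow_mult_distr.
      transitivity (column Stirling2 (n i) r * ((/ INR (n i)) ^ r * t ^ r)); [f_equal; apply Rmult_comm|].
      symmetry; apply Rmult_assoc.
    - rewrite Hkz in HPb.
      assert (E : (xlnx (1 - t) + 1) / z = INR (n i) * (stirling2_rate t + 0)).
      { unfold z, xlnx, stirling2_rate; field; lra. }
      rewrite E in HPb. rewrite exp_plus, exp_Ropp, exp_ln by lra. exact HPb. }
  split.
  + intros r. destruct (Hser t0 Ht0) as [P [HP [_ HP2]]].
    eapply Rle_trans; [|exact HP2].
    apply (is_series_term_le (fun r => a i r * t0 ^ r)); [|exact HP].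
    intros q; apply Rmult_le_pos; [|apply pow_le; lra].
    apply Rmult_le_pos; [apply tri_pos|apply pow_le, Hin].
  + destruct (Hser t Ht1) as [P [HP [HP1 _]]].
    (* The constant [C1 = 1] leaves strict room below the infinite sum [P], so a finite partial sum
       suffices. *)
    assert (HlP : exp (INR (n i) * (stirling2_rate t + 0) - 1) < P).
    { eapply Rlt_le_trans; [|exact HP1]. apply exp_increasing; lra. }
    destruct (is_lim_seq_eventually_gt _ P _ HP HlP) as [M HM].
    exists M. rewrite <- sum_n_Reals. apply Rlt_le, HM; lia.
Qed.

(** * Limits of ratios in the Eulerian triangle *)

Lemma euler_outgrows (n : nat -> nat) (kappa x0 x : R) :
  is_lim_seq (fun i => INR (n i)) p_infty ->
  0 < x0 < 1 -> 0 < x < 1 -> kappa * ln (x / x0) < euler_rate x - euler_rate x0 ->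
  outgrows (fun i => tri Euler (n i)) (fun i => INR (n i)) kappa x0 x.
Proof.
intros HN Hx0 Hx Hr.
assert (Hl0 := ln_neg x0 Hx0).
set (d := euler_rate x - euler_rate x0 - kappa * ln (x / x0)).
assert (Hd : 0 < d) by (unfold d; lra).
(* With [s = 1 - eta] in [euler_term_le_exp], the rate at [x0] grows by at most
   [x0 * eta / (1 - x0)], which is below the available gap [d]. *)
set (eta := Rmin (1 / 2) (d * (1 - x0) / 2)).
assert (Heta : 0 < eta /\ eta < 1 /\ eta < d * (1 - x0)).
{ assert (0 < d * (1 - x0)) by (apply Rmult_lt_0_compat; lra).
  generalize (Rmin_l (1 / 2) (d * (1 - x0) / 2)) (Rmin_r (1 / 2) (d * (1 - x0) / 2)).
  fold eta. intros. split; [apply Rmin_glb_lt; lra|lra]. }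
apply (outgrows_of_exp_bounds _ _ (fun i => ln (INR (n i)) - 1) kappa x0 x
   (ln (1 - x0 * (1 - eta)) - ln (- ln x0)) (euler_rate x)
   (- ln x0 - ln (1 - (1 - eta))) (- ln (1 - x)) HN).
- assert (Hxe : x0 * (1 - eta) < x0 * 1) by (apply Rmult_lt_compat_l; lra).
  assert (L := ln_le_sub_1 ((1 - x0 * (1 - eta)) / (1 - x0))
    ltac:(apply Rdiv_lt_0_compat; lra)).
  rewrite ln_div in L by lra.
  replace ((1 - x0 * (1 - eta)) / (1 - x0) - 1) with (x0 * eta / (1 - x0)) in L by (field; lra).
  assert (x0 * eta / (1 - x0) < d).
  { apply Rlt_div_l; [lra|]. apply Rlt_trans with (1 * eta); [|lra].
    apply Rmult_lt_compat_r; lra. }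
  unfold d in *. unfold euler_rate at 2 in H. rewrite ln_div in H by lra. lra.
- generalize (is_lim_seq_p_infty_gt _ 0 HN). apply filter_imp; intros i Hi.
  assert (Hn : (0 < n i)%nat) by (apply INR_lt; exact Hi). split.
  + intros k; apply euler_term_le_exp; try assumption; lra.
  + exists (n i); apply euler_sum_ge_exp; assumption.
Qed.

Lemma euler_outgrows_1 (n : nat -> nat) (x : R) :
  is_lim_seq (fun i => INR (n i)) p_infty -> 0 < x < 1 ->
  outgrows (fun i => tri Euler (n i)) (fun i => INR (n i)) (1 / 2) 1 x.
Proof.
intros HN Hx.
assert (Hr := euler_rate_gt_half x Hx).
set (eps := (euler_rate x - 1 / 2 * ln x) / 2).
assert (Heps : 0 < eps) by (unfold eps; lra).
apply (outgrows_of_exp_bounds _ _ (fun i => ln (INR (n i)) - 1) _ 1 x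
   eps (euler_rate x) (1 + eps - ln eps) (- ln (1 - x)) HN).
- rewrite Rdiv_1_r. unfold eps; lra.
- generalize (is_lim_seq_p_infty_gt _ 0 HN). apply filter_imp; intros i Hi.
  assert (Hn : (0 < n i)%nat) by (apply INR_lt; exact Hi). split.
  + intros k; rewrite pow1, Rmult_1_r; apply euler_term_le_row; assumption.
  + exists (n i); apply euler_sum_ge_exp; assumption.
Qed.

Definition euler_ratio_lim (kappa x0 : R) : Prop :=
  forall n k : nat -> nat,
    is_lim_seq (fun i => INR (n i)) p_infty ->
    is_lim_seq (fun i => INR (k i) / INR (n i)) kappa ->
    is_lim_seq (fun i => tri Euler (n i) (k i) / tri Euler (n i) (S (k i))) x0.

Lemma euler_entries_pos (n k : nat -> nat) (kappa : R) :
  0 < kappa < 1 ->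
  is_lim_seq (fun i => INR (n i)) p_infty ->
  is_lim_seq (fun i => INR (k i) / INR (n i)) kappa ->
  eventually (fun i => (S (S (k i)) <= n i)%nat /\
     0 < tri Euler (n i) (k i) /\ 0 < tri Euler (n i) (S (k i))).
Proof.
intros Hk HN HJ.
assert (Hc : kappa < (1 + kappa) / 2) by lra.
generalize (filter_and _ _
  (is_lim_seq_div_lt_eventually n k kappa _ Hc HN HJ)
  (is_lim_seq_p_infty_gt _ (4 / (1 - kappa)) HN)).
apply filter_imp; intros i [H1 H2].
assert (Hki : (S (S (k i)) <= n i)%nat).
{ apply INR_le. rewrite !S_INR.
  apply Rlt_div_l in H2; [|lra]. lra. }
split; [exact Hki|].
replace (n i) with (S (n i - 1)) by lia. split; apply euler_pos; lia.
Qed.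

Lemma euler_ratio_lt_half (kappa : R) :
  0 < kappa < 1 / 2 -> exists x0, 0 < x0 /\ euler_ratio_lim kappa x0.
Proof.
intros Hk. destruct (euler_mean_surj kappa Hk) as [x0 [Hx0 Hmean]].
exists x0; split; [lra|]. intros n k HN HJ.
apply (ratio_is_lim (fun i => tri Euler (n i)) (fun i => INR (n i)) k kappa x0)
  with (e := 1 - x0); try assumption; try lra.
- intros i; apply euler_log_concave.
- intros i j; apply tri_pos.
- generalize (euler_entries_pos n k kappa ltac:(lra) HN HJ).
  apply filter_imp; tauto.
- intros x He Hx Hne. apply Rabs_lt_between in He.
  apply euler_outgrows; try assumption; try lra.
  apply euler_rate_strict; lra.
Qed.

Lemma is_lim_seq_div_reflect (n k : nat -> nat) (kappa : R) :
  0 < kappa < 1 ->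
  is_lim_seq (fun i => INR (n i)) p_infty ->
  is_lim_seq (fun i => INR (k i) / INR (n i)) kappa ->
  is_lim_seq (fun i => INR (n i - 2 - k i) / INR (n i)) (1 - kappa).
Proof.
intros Hk HN HJ.
apply is_lim_seq_ext_loc with (fun i => 1 - 2 * / INR (n i) - INR (k i) / INR (n i)).
{ generalize (filter_and _ _ (euler_entries_pos n k kappa Hk HN HJ)
    (is_lim_seq_p_infty_gt _ 0 HN)).
  apply filter_imp; intros i [[H1 _] H2].
  rewrite <- Nat.sub_add_distr, minus_INR, plus_INR by lia. simpl INR. field; lra. }
replace (1 - kappa) with (1 - 2 * 0 - kappa) by ring.
apply is_lim_seq_minus'; [|exact HJ].
apply is_lim_seq_minus'; [apply is_lim_seq_const|].
apply (is_lim_seq_scal_l _ 2 0).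
apply (is_lim_seq_inv _ p_infty); [exact HN|discriminate].
Qed.

(** The ratio at [k] is the inverse of the ratio at [n - 2 - k]. *)
Lemma euler_reflect (n k : nat) :
  (S (S k) <= n)%nat ->
  tri Euler n k = tri Euler n (S (n - 2 - k)) /\
  tri Euler n (S k) = tri Euler n (n - 2 - k).
Proof.
intros H. destruct n as [|n]; [lia|].
rewrite (euler_sym n k), (euler_sym n (S k)) by lia.
split; f_equal; lia.
Qed.

(** Points [x < 1] only show that the ratio is eventually at least [1 - e]. Reflection preserves
    [kappa = 1 / 2], so the same bound at [n - 2 - k] yields the upper bound [/ (1 - e)]. *)
Lemma euler_ratio_half : euler_ratio_lim (1 / 2) 1.
Proof.
assert (Hge : forall (n k : nat -> nat) (e : R),
    is_lim_seq (fun i => INR (n i)) p_infty ->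
    is_lim_seq (fun i => INR (k i) / INR (n i)) (1 / 2) -> 0 < e < 1 ->
    eventually (fun i => (1 - e) * tri Euler (n i) (S (k i)) <= tri Euler (n i) (k i))).
{ intros n k e HN HJ He.
  apply (ratio_eventually_ge (fun i => tri Euler (n i)) (fun i => INR (n i)) k (1 / 2) 1)
    with (x := 1 - e / 2); try assumption; try lra.
  - intros i; apply euler_log_concave.
  - intros i j; apply tri_pos.
  - generalize (euler_entries_pos n k (1 / 2) ltac:(lra) HN HJ).
    apply filter_imp; tauto.
  - apply euler_outgrows_1; [exact HN|lra]. }
intros n k HN HJ.
apply is_lim_seq_spec; intros [eps Heps]; simpl.
set (e := Rmin eps 1 / 4).
assert (He : 0 < e < 1 /\ e < eps /\ 1 < (1 + eps) * (1 - e)).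
{ assert (0 < Rmin eps 1) by (apply Rmin_glb_lt; lra).
  assert (H1 := Rmin_l eps 1). assert (H2 := Rmin_r eps 1).
  assert (H3 := Rmult_le_compat_l eps _ _ (Rlt_le _ _ Heps) H2).
  unfold e; repeat split; lra. }
assert (HJ' : is_lim_seq (fun i => INR (n i - 2 - k i) / INR (n i)) (1 / 2)).
{ replace (1 / 2) with (1 - 1 / 2) by field.
  apply is_lim_seq_div_reflect; [lra|exact HN|exact HJ]. }
assert (Hhalf : 0 < 1 / 2 < 1) by lra.
generalize (filter_and _ _ (euler_entries_pos n k (1 / 2) Hhalf HN HJ)
  (filter_and _ _ (Hge n k e HN HJ (proj1 He))
     (Hge n (fun i => n i - 2 - k i)%nat e HN HJ' (proj1 He)))).
apply filter_imp; intros i [[H1 [H2 H3]] [H4 H5]].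
destruct (euler_reflect _ _ H1) as [E1 E2]. rewrite <- E1, <- E2 in H5.
apply Rle_div_r in H4; [|exact H3].
assert (H6 : tri Euler (n i) (k i) / tri Euler (n i) (S (k i)) < 1 + eps).
{ apply Rlt_div_l; [exact H3|].
  apply Rmult_lt_reg_l with (1 - e); [lra|].
  eapply Rle_lt_trans; [exact H5|].
  generalize (Rmult_lt_compat_r _ _ _ H3 (proj2 (proj2 He))). lra. }
apply Rabs_lt_between; lra.
Qed.

Lemma euler_ratio (kappa : R) :
  0 < kappa < 1 -> exists x0, 0 < x0 /\ euler_ratio_lim kappa x0.
Proof.
intros Hk. destruct (Rtotal_order kappa (1 / 2)) as [H|[->|H]].
- apply euler_ratio_lt_half; lra.
- exists 1; split; [lra|exact euler_ratio_half].
- destruct (euler_ratio_lt_half (1 - kappa) ltac:(lra)) as [x0 [Hx0 Hlim]].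
  exists (/ x0); split; [apply Rinv_0_lt_compat, Hx0|]. intros n k HN HJ.
  assert (HJ' := is_lim_seq_div_reflect n k kappa Hk HN HJ).
  specialize (Hlim n (fun i => n i - 2 - k i)%nat HN HJ').
  apply (is_lim_seq_inv _ x0) in Hlim; [|intros E; injection E; lra].
  apply is_lim_seq_ext_loc with (2 := Hlim).
  generalize (euler_entries_pos n k kappa Hk HN HJ).
  apply filter_imp; intros i [H1 [H2 H3]].
  destruct (euler_reflect _ _ H1) as [E1 E2]. rewrite <- E1, <- E2. field; lra.
Qed.

(** * From the quotient [u] of the two summands of the recursion to [p1 = u / (1 + u)] *)

Lemma is_lim_seq_odds (u : nat -> R) (v : R) :
  0 < v -> is_lim_seq u v -> is_lim_seq (fun i => u i / (1 + u i)) (v / (1 + v)).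
Proof.
intros Hv Hu. apply is_lim_seq_div'; [exact Hu| |lra].
apply is_lim_seq_plus'; [apply is_lim_seq_const|exact Hu].
Qed.

Lemma odds_bounds (v : R) : 0 < v -> 0 <= v / (1 + v) <= 1.
Proof.
intros Hv; split.
- apply Rlt_le, Rdiv_lt_0_compat; lra.
- apply Rle_div_l; lra.
Qed.

Section Limits.
Variables (lambda : R) (m l : nat -> nat).
Hypothesis Hlambda : 0 < lambda.
Hypothesis Hm : filterlim m eventually eventually.
Hypothesis Hl : filterlim l eventually eventually.
Hypothesis Hml : is_lim_seq (fun i => INR (m i) / INR (l i)) (1 + lambda).

Lemma lim_INR_l : is_lim_seq (fun i => INR (l i)) p_infty.
Proof. exact (is_lim_seq_subseq INR p_infty l Hl is_lim_seq_INR). Qed.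

Lemma lim_INR_m_pred : is_lim_seq (fun i => INR (m i - 1)) p_infty.
Proof.
apply (is_lim_seq_subseq (fun j => INR (j - 1)) p_infty m Hm).
apply is_lim_seq_incr_1. apply is_lim_seq_ext with INR; [|apply is_lim_seq_INR].
intros j; f_equal; lia.
Qed.

Lemma eventually_l_lt_m : eventually (fun i => (2 <= l i)%nat /\ (l i < m i)%nat).
Proof.
generalize (filter_and _ _ (is_lim_seq_p_infty_gt _ 2 lim_INR_l)
  (is_lim_seq_eventually_gt _ _ 1 Hml ltac:(lra))).
apply filter_imp; intros i [H1 H2]. split.
- apply INR_le; simpl; lra.
- apply INR_lt. apply Rlt_div_r in H2; lra.
Qed.

Lemma lim_inv_l : is_lim_seq (fun i => / INR (l i)) 0.
Proof. apply (is_lim_seq_inv _ p_infty); [exact lim_INR_l|discriminate]. Qed.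

Lemma lim_l_div_m : is_lim_seq (fun i => INR (l i) / INR (m i)) (/ (1 + lambda)).
Proof.
assert (H := Hml).
apply (is_lim_seq_inv _ (1 + lambda)) in H; [|intros E; injection E; lra].
apply is_lim_seq_ext_loc with (2 := H).
generalize eventually_l_lt_m; apply filter_imp; intros i [H1 H2].
assert (0 < INR (l i)) by (apply lt_0_INR; lia).
assert (0 < INR (m i)) by (apply lt_0_INR; lia).
field; lra.
Qed.

Lemma lim_pred_l_div_pred_m :
  is_lim_seq (fun i => INR (l i - 1) / INR (m i - 1)) (/ (1 + lambda)).
Proof.
apply is_lim_seq_ext_loc with
  (fun i => (1 - / INR (l i)) / (INR (m i) / INR (l i) - / INR (l i))).
{ generalize eventually_l_lt_m; apply filter_imp; intros i [H1 H2].
  assert (1 < INR (l i)) by (apply lt_1_INR; lia).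
  assert (1 < INR (m i)) by (apply lt_1_INR; lia).
  rewrite !minus_INR by lia. simpl INR. field; lra. }
replace (/ (1 + lambda)) with ((1 - 0) / (1 + lambda - 0)) by (field; lra).
apply is_lim_seq_div'; [| |lra].
- apply is_lim_seq_minus'; [apply is_lim_seq_const|exact lim_inv_l].
- apply is_lim_seq_minus'; [exact Hml|exact lim_inv_l].
Qed.

Lemma lim_diff_div_l : is_lim_seq (fun i => INR (m i - l i - 1) / INR (l i)) lambda.
Proof.
apply is_lim_seq_ext_loc with (fun i => INR (m i) / INR (l i) - 1 - / INR (l i)).
{ generalize eventually_l_lt_m; apply filter_imp; intros i [H1 H2].
  assert (1 < INR (l i)) by (apply lt_1_INR; lia).
  rewrite !minus_INR by lia. simpl INR. field; lra. }
replace lambda with (1 + lambda - 1 - 0) by ring.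
apply is_lim_seq_minus'; [|exact lim_inv_l].
apply is_lim_seq_minus'; [exact Hml|apply is_lim_seq_const].
Qed.

Lemma lim_diff_div_succ_l :
  is_lim_seq (fun i => (INR (m i) - INR (l i)) / (INR (l i) + 1)) lambda.
Proof.
apply is_lim_seq_ext_loc with
  (fun i => (INR (m i) / INR (l i) - 1) / (1 + / INR (l i))).
{ generalize eventually_l_lt_m; apply filter_imp; intros i [H1 H2].
  assert (1 < INR (l i)) by (apply lt_1_INR; lia). field; lra. }
replace (Finite lambda) with (Finite ((1 + lambda - 1) / (1 + 0))) by (f_equal; field).
apply is_lim_seq_div'; [| |lra].
- apply is_lim_seq_minus'; [exact Hml|apply is_lim_seq_const].
- apply is_lim_seq_plus'; [apply is_lim_seq_const|exact lim_inv_l].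
Qed.

End Limits.

Definition has_p1_limit (c : triangle_case) (lambda v : R) : Prop :=
  0 <= v <= 1 /\
  forall m l : nat -> nat,
    filterlim m eventually eventually ->
    filterlim l eventually eventually ->
    is_lim_seq (fun i => INR (m i) / INR (l i)) (1 + lambda) ->
    is_lim_seq (fun i => p1 (coef_a c) (coef_b c) (m i) (l i)) v.

(** By absorption [p1] equals [l / m] exactly. *)
Lemma pascal_p1_limit (lambda : R) :
  0 < lambda -> has_p1_limit Pascal lambda (/ (1 + lambda)).
Proof.
intros Hlambda. split.
{ generalize (odds_bounds lambda Hlambda).
  replace (lambda / (1 + lambda)) with (1 - / (1 + lambda)) by (field; lra). lra. }
intros m l Hm Hl Hml.
apply is_lim_seq_ext_loc with (2 := lim_l_div_m lambda m l Hlambda Hl Hml).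
generalize (eventually_l_lt_m lambda m l Hlambda Hl Hml).
apply filter_imp; intros i [H1 H2].
destruct (m i) as [|n]; [lia|]. destruct (l i) as [|k]; [lia|].
rewrite p1_S. cbn [coef_a]. change (INR 1) with 1.
assert (Hp := pascal_pos (S n) (S k) ltac:(lia)).
assert (Ha := pascal_absorb n k).
assert (0 < INR (S n)) by (apply lt_0_INR; lia).
apply Rmult_eq_reg_r with (INR (S n) * tri Pascal (S n) (S k)); [|nra].
transitivity (INR (S k) * tri Pascal (S n) (S k)); [field; lra|].
rewrite Ha; field; lra.
Qed.

Lemma stirling1_p1_limit (lambda : R) :
  0 < lambda -> exists v, has_p1_limit Stirling1 lambda v.
Proof.
intros Hlambda.
destruct (stirling1_ratio (/ (1 + lambda))) as [t0 [Ht0 Hlim]].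
{ split; [apply Rinv_0_lt_compat; lra|].
  rewrite <- Rinv_1. apply Rinv_lt_contravar; lra. }
exists (t0 / (1 + t0)); split; [apply odds_bounds, Ht0|]. intros m l Hm Hl Hml.
(* The recursion for [T(m,l)] compares the entries [l - 1] and [l] of row [m - 1]. *)
specialize (Hlim (fun i => m i - 1)%nat (fun i => l i - 1)%nat (lim_INR_m_pred m Hm)
  (lim_pred_l_div_pred_m lambda m l Hlambda Hl Hml)).
apply is_lim_seq_odds in Hlim; [|exact Ht0].
apply is_lim_seq_ext_loc with (2 := Hlim).
generalize (eventually_l_lt_m lambda m l Hlambda Hl Hml).
apply filter_imp; intros i [H1 H2].
destruct (m i) as [|n]; [lia|]. destruct (l i) as [|k]; [lia|].
rewrite p1_S, !Nat.sub_succ, !Nat.sub_0_r, stirling1_S. cbn [coef_a shift].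
change (INR 1) with 1.
assert (0 < tri Stirling1 n (S k)) by (apply stirling1_pos; lia).
assert (0 < INR n) by (apply lt_0_INR; lia).
assert (0 < INR n * tri Stirling1 n (S k)) by (apply Rmult_lt_0_compat; assumption).
generalize (tri_pos Stirling1 n k); intros. field; lra.
Qed.

Lemma stirling2_p1_limit (lambda : R) :
  0 < lambda -> exists v, has_p1_limit Stirling2 lambda v.
Proof.
intros Hlambda.
destruct (stirling2_ratio lambda Hlambda) as [t0 [Ht0 Hlim]].
exists (1 - t0); split; [lra|]. intros m l Hm Hl Hml.
(* Here [1 - p1 = l * T(m-1,l) / T(m,l)], a quotient of consecutive entries of column [l], at
   distances [m - l - 1] and [m - l] from the diagonal. *)
specialize (Hlim l (fun i => m i - l i - 1)%nat (lim_INR_l l Hl)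
  (lim_diff_div_l lambda m l Hlambda Hl Hml)).
apply (is_lim_seq_minus' (fun _ => 1) _ 1 _ (is_lim_seq_const 1)) in Hlim.
apply is_lim_seq_ext_loc with (2 := Hlim).
generalize (eventually_l_lt_m lambda m l Hlambda Hl Hml).
apply filter_imp; intros i [H1 H2].
destruct (m i) as [|n]; [lia|]. destruct (l i) as [|k]; [lia|].
rewrite p1_S. assert (Hp := stirling2_column_pos k (S (S n - S k - 1))).
revert Hp. unfold column.
replace (S (S n - S k - 1) + S k)%nat with (S n) by lia.
replace (S n - S k - 1 + S k)%nat with n by lia.
rewrite tri_S. cbn [coef_a coef_b shift]. change (INR 1) with 1.
intros Hp. field; lra.
Qed.

Lemma euler_p1_limit (lambda : R) :
  0 < lambda -> exists v, has_p1_limit Euler lambda v.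
Proof.
intros Hlambda.
assert (Hk : 0 < / (1 + lambda) < 1).
{ split; [apply Rinv_0_lt_compat; lra|].
  rewrite <- Rinv_1. apply Rinv_lt_contravar; lra. }
destruct (euler_ratio _ Hk) as [x0 [Hx0 Hlim]].
assert (Hlx : 0 < lambda * x0) by (apply Rmult_lt_0_compat; lra).
(* The quotient of the summands is [(m - l) / (l + 1)], with limit [lambda], times the ratio of
   entries, with limit [x0]. *)
exists (lambda * x0 / (1 + lambda * x0)); split; [apply odds_bounds, Hlx|].
intros m l Hm Hl Hml.
assert (HN := lim_INR_m_pred m Hm).
assert (HJ := lim_pred_l_div_pred_m lambda m l Hlambda Hl Hml).
specialize (Hlim (fun i => m i - 1)%nat (fun i => l i - 1)%nat HN HJ).
apply (is_lim_seq_mult' _ _ _ _ (lim_diff_div_succ_l lambda m l Hlambda Hl Hml)) in Hlim.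
apply is_lim_seq_odds in Hlim; [|exact Hlx].
apply is_lim_seq_ext_loc with (2 := Hlim).
generalize (filter_and _ _ (eventually_l_lt_m lambda m l Hlambda Hl Hml)
  (euler_entries_pos _ _ _ Hk HN HJ)).
apply filter_imp; intros i [[H1 H2] [_ [H3 H4]]].
destruct (m i) as [|n]; [lia|]. destruct (l i) as [|k]; [lia|].
rewrite !Nat.sub_succ, !Nat.sub_0_r in H3, H4 |- *.
rewrite p1_S, euler_S. cbn [coef_a shift]. rewrite minus_INR by lia.
assert (Hkn : INR (S k) < INR (S n)) by (apply lt_INR; lia).
assert (Hk0 := pos_INR (S k)).
assert (0 < (INR (S n) - INR (S k)) * tri Euler n k) by (apply Rmult_lt_0_compat; lra).
assert (0 < (INR (S k) + 1) * tri Euler n (S k)) by (apply Rmult_lt_0_compat; lra).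
field; lra.
Qed.

Lemma p1_limit_exists (c : triangle_case) (lambda : R) :
  0 < lambda -> exists v, has_p1_limit c lambda v.
Proof.
destruct c; intros Hlambda.
- exists (/ (1 + lambda)); apply pascal_p1_limit, Hlambda.
- apply stirling2_p1_limit, Hlambda.
- apply stirling1_p1_limit, Hlambda.
- apply euler_p1_limit, Hlambda.
Qed.

Theorem theorem1 (c : triangle_case) :
  exists phi : R -> R,
    (forall x : R, 0 < x -> 0 <= phi x <= 1) /\
    (forall lambda : R, 0 < lambda ->
     forall m l : nat -> nat,
       filterlim m eventually eventually ->
       filterlim l eventually eventually ->
       is_lim_seq (fun i => INR (m i) / INR (l i)) (1 + lambda) ->
       is_lim_seq (fun i => p1 (coef_a c) (coef_b c) (m i) (l i)) (phi lambda)).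
Proof.
(* Each limit is known only to exist, so [phi] is obtained by choice; the guard [0 < lambda] makes
   the relation total. *)
destruct (functional_choice (fun lambda v => 0 < lambda -> has_p1_limit c lambda v))
  as [phi Hphi].
{ intros lambda. destruct (Rlt_dec 0 lambda) as [H|H].
  - destruct (p1_limit_exists c lambda H) as [v Hv]; exists v; intros _; exact Hv.
  - exists 0; intros H'; contradiction. }
exists phi; split.
- intros x Hx; apply (Hphi x Hx).
- intros lambda Hlambda; apply (Hphi lambda Hlambda).
Qed.
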